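(* Let $H$ be a Hopf algebra over a field $k$, let $s_1,s_2\colon H\otimes H\to H$ be two linear maps and let $s:=(s_1\otimes s_2)\circ\Delta_{H\otimes H}$. Write ${}^hl:=s_1(h\otimes l)$ and $h^l:=s_2(h\otimes l)$. Assume that $H$ is a left $H$-module coalgebra via $s_1$ and a right $H$-module coalgebra via $s_2$. If $${}^{h_{(1)}}l_{(1)}\,{h_{(2)}}^{l_{(2)}}=hl\quad\text{for all }h,l\in H,$$ then $(H,s)$ is a braiding operator. In particular $s$ is a bijective solution of the braid equation.
   Context: All tensor products are over $k$; Sweedler notation $\Delta(h)=h_{(1)}\otimes h_{(2)}$ is used; $\mu$ and $\eta$ are the multiplication and unit of $H$; $H$ inside a tensor product of maps denotes $\mathrm{id}_H$. $\Delta_{H\otimes H}$ is the comultiplication of the tensor product coalgebra, so $s(h\otimes l)={}^{h_{(1)}}l_{(1)}\otimes{h_{(2)}}^{l_{(2)}}$. A map $s\colon H\otimes H\to H\otimes H$ is a solution of the braid equation if $(s\otimes H)(H\otimes s)(s\otimes H)=(H\otimes s)(s\otimes H)(H\otimes s)$; it is a set-theoretic type solution if moreover it is a coalgebra endomorphism of $H\otimes H$. A weak braiding operator is a pair $(H,s)$ of a Hopf algebra $H$ and a set-theoretic type solution $s$ of the braid equation on $H$ such that $s(\mu\otimes H)=(H\otimes\mu)(s\otimes H)(H\otimes s)$, $s(H\otimes\mu)=(\mu\otimes H)(H\otimes s)(s\otimes H)$, $s(\eta\otimes H)=H\otimes\eta$ and $s(H\otimes\eta)=\eta\otimes H$. It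 is a braiding operator if in addition $\mu=\mu\circ s$. *)

(* Defs.v *)
From HB Require Import structures.
From mathcomp Require Import all_boot all_order all_algebra.
From mathcomp Require Import boolp.

Set Implicit Arguments.
Unset Strict Implicit.
Unset Printing Implicit Defensive.

Import GRing.Theory.
Local Open Scope ring_scope.
Local Open Scope quotient_scope.

(* Tensor product of two (possibly infinite-dimensional) k-spaces.  A finite
   sequence [:: (u_1, v_1); ...; (u_n, v_n)] stands for the formal sum of the
   u_i (x) v_i; two formal sums are identified when no bilinear map separates
   them.  The universal property is tliftE, tlift_uniq below. *)
Section TensorType.
Variables (k : fieldType) (U V : lmodType k).

Definition fsum (W : zmodType) (f : U -> V -> W) (s : seq (U * V)) : W :=
  \sum_(p <- s) f p.1 p.2.

Definition tens_eq (s t : seq (U * V)) : bool :=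
  `[< forall (W : lmodType k) (f : U -> V -> W),
        bilinear_for *:%R *:%R f -> fsum f s = fsum f t >].

Lemma tens_eq_refl : reflexive tens_eq.
Proof. by move=> s; apply/asboolP. Qed.

Lemma tens_eq_sym : symmetric tens_eq.
Proof. by move=> s t; apply/asboolP/asboolP => H W f /H. Qed.

Lemma tens_eq_trans : transitive tens_eq.
Proof.
by move=> t s r /asboolP H1 /asboolP H2; apply/asboolP => W f bf;
  rewrite H1 ?H2.
Qed.

Canonical tens_equiv := EquivRel tens_eq tens_eq_refl tens_eq_sym tens_eq_trans.

Definition tens := {eq_quot tens_eq}.
HB.instance Definition _ := Choice.copy tens {eq_quot tens_eq}.

Definition tlift (W : zmodType) (f : U -> V -> W) (x : tens) : W :=
  fsum f (repr x).

Definition tpure (u : U) (v : V) : tens := \pi_tens [:: (u, v)].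

Lemma tlift_pi (W : lmodType k) (f : U -> V -> W) s :
  bilinear_for *:%R *:%R f -> tlift f (\pi_tens s) = fsum f s.
Proof.
move=> bf; have /eqmodP/asboolP H : repr (\pi_tens s) = s %[mod tens].
  by rewrite reprK.
exact: H.
Qed.

Lemma tens_eqP (x y : tens) :
  (forall (W : lmodType k) (f : U -> V -> W),
     bilinear_for *:%R *:%R f -> tlift f x = tlift f y) -> x = y.
Proof.
by move=> H; rewrite -[x]reprK -[y]reprK; apply/eqmodP/asboolP.
Qed.

Definition tens0 : tens := \pi_tens [::].
Definition tens_add (x y : tens) : tens := \pi_tens (repr x ++ repr y).
Definition tens_scale (a : k) (x : tens) : tens :=
  \pi_tens [seq (a *: p.1, p.2) | p <- repr x].
Definition tens_opp (x : tens) : tens := tens_scale (-1) x.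

Section Ops.
Variables (W : lmodType k) (f : U -> V -> W).
Hypothesis bf : bilinear_for *:%R *:%R f.

Lemma tlift_tens0 : tlift f tens0 = 0.
Proof. by rewrite tlift_pi // /fsum big_nil. Qed.

Lemma tlift_tens_add x y : tlift f (tens_add x y) = tlift f x + tlift f y.
Proof. by rewrite tlift_pi // /fsum big_cat. Qed.

Lemma tlift_tens_scale a x : tlift f (tens_scale a x) = a *: tlift f x.
Proof.
rewrite tlift_pi // /fsum big_map scaler_sumr; apply: eq_bigr => p _ /=.
have h v : f 0 v = 0.
  by have := bf.1 v (-1) 0 0; rewrite /= scaler0 addr0 scaleN1r addNr.
by have := bf.1 p.2 a p.1 0; rewrite !addr0 h addr0.
Qed.

Lemma tlift_tens_opp x : tlift f (tens_opp x) = - tlift f x.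
Proof. by rewrite tlift_tens_scale scaleN1r. Qed.
End Ops.

Let tE := (tlift_tens0, tlift_tens_add, tlift_tens_scale, tlift_tens_opp).

Lemma tens_addA : associative tens_add.
Proof. by move=> x y z; apply: tens_eqP => W f bf; rewrite !tE ?addrA. Qed.
Lemma tens_addC : commutative tens_add.
Proof. by move=> x y; apply: tens_eqP => W f bf; rewrite !tE // addrC. Qed.
Lemma tens_add0 : left_id tens0 tens_add.
Proof. by move=> x; apply: tens_eqP => W f bf; rewrite !tE // add0r. Qed.
Lemma tens_addN : left_inverse tens0 tens_opp tens_add.
Proof. by move=> x; apply: tens_eqP => W f bf; rewrite !tE // addNr. Qed.

HB.instance Definition _ :=
  GRing.isZmodule.Build tens tens_addA tens_addC tens_add0 tens_addN.

Lemma tens_scaleA a b x : tens_scale a (tens_scale b x) = tens_scale (a * b) x.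
Proof. by apply: tens_eqP => W f bf; rewrite !tE // scalerA. Qed.
Lemma tens_scale1 : left_id 1 tens_scale.
Proof. by move=> x; apply: tens_eqP => W f bf; rewrite !tE // scale1r. Qed.
Lemma tens_scaleDr : right_distributive tens_scale +%R.
Proof. by move=> a x y; apply: tens_eqP => W f bf; rewrite !tE // scalerDr. Qed.
Lemma tens_scaleDl x : {morph tens_scale^~ x : a b / a + b}.
Proof. by move=> a b; apply: tens_eqP => W f bf; rewrite !tE // scalerDl. Qed.

HB.instance Definition _ := GRing.Zmodule_isLmodule.Build k tens
  tens_scaleA tens_scale1 tens_scaleDr tens_scaleDl.

End TensorType.

Notation "U ⊗ V" := (tens U V) (at level 40, left associativity).
Notation "u ⊗ₜ v" := (tpure u v) (at level 40, left associativity).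

Section Universal.
Variables (k : fieldType) (U V : lmodType k).

Lemma tlift_linear (W : lmodType k) (f : U -> V -> W) :
  bilinear_for *:%R *:%R f -> linear (tlift f).
Proof.
move=> bf a x y; rewrite -(tlift_tens_scale bf).
exact: tlift_tens_add bf _ _.
Qed.

Definition tlift_lin (W : lmodType k) (f : U -> V -> W)
    (bf : bilinear_for *:%R *:%R f) : {linear U ⊗ V -> W} :=
  HB.pack (tlift f) (GRing.isLinear.Build k _ _ _ (tlift f) (tlift_linear bf)).

Lemma tliftE (W : lmodType k) (f : U -> V -> W) u v :
  bilinear_for *:%R *:%R f -> tlift f (u ⊗ₜ v) = f u v.
Proof. by move=> bf; rewrite tlift_pi // /fsum big_seq1. Qed.

Lemma tpure_bilinear : bilinear_for *:%R *:%R (@tpure k U V).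
Proof.
split=> [v a u u' | u a v v']; apply: tens_eqP => W f bf.
  by rewrite tlift_linear // !tliftE //; apply: (bf.1 v).
by rewrite tlift_linear // !tliftE //; apply: (bf.2 u).
Qed.

Lemma tens_sum (x : U ⊗ V) :
  exists s : seq (U * V), x = \sum_(p <- s) (p.1 ⊗ₜ p.2).
Proof.
exists (repr x); apply: tens_eqP => W f bf.
have -> : tlift f (\sum_(p <- repr x) (p.1 ⊗ₜ p.2)) = fsum f (repr x).
  rewrite -[LHS]/(tlift_lin bf _) linear_sum; apply: eq_bigr => p _.
  exact: tliftE.
by [].
Qed.

Lemma tens_ext (W : lmodType k) (F G : {linear U ⊗ V -> W}) :
  (forall u v, F (u ⊗ₜ v) = G (u ⊗ₜ v)) -> F =1 G.
Proof.
move=> FG x; have [s ->] := tens_sum x.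
by rewrite !linear_sum; apply: eq_bigr => p _.
Qed.

Lemma tlift_uniq (W : lmodType k) (f : U -> V -> W) (F : {linear U ⊗ V -> W}) :
  bilinear_for *:%R *:%R f -> (forall u v, F (u ⊗ₜ v) = f u v) -> F =1 tlift f.
Proof.
move=> bf FE.
by apply: (@tens_ext W F (tlift_lin bf)) => u v; rewrite FE /= tliftE.
Qed.

Lemma tpureDl u u' v : ((u + u') ⊗ₜ v = u ⊗ₜ v + u' ⊗ₜ v :> U ⊗ V).
Proof. by have := tpure_bilinear.1 v 1 u u'; rewrite /= !scale1r. Qed.

Lemma tpureDr u v v' : (u ⊗ₜ (v + v') = u ⊗ₜ v + u ⊗ₜ v' :> U ⊗ V).
Proof. by have := tpure_bilinear.2 u 1 v v'; rewrite /= !scale1r. Qed.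

Lemma tpure0l v : (0 ⊗ₜ v = 0 :> U ⊗ V).
Proof.
by have := tpure_bilinear.1 v (-1) 0 0; rewrite /= scaler0 addr0 scaleN1r addNr.
Qed.

Lemma tpureZl a u v : ((a *: u) ⊗ₜ v = a *: (u ⊗ₜ v) :> U ⊗ V).
Proof.
by have := tpure_bilinear.1 v a u 0; rewrite /= !addr0 tpure0l addr0.
Qed.

Lemma tpure0r u : (u ⊗ₜ 0 = 0 :> U ⊗ V).
Proof.
by have := tpure_bilinear.2 u (-1) 0 0; rewrite /= scaler0 addr0 scaleN1r addNr.
Qed.

Lemma tpureZr a u v : (u ⊗ₜ (a *: v) = a *: (u ⊗ₜ v) :> U ⊗ V).
Proof.
by have := tpure_bilinear.2 u a v 0; rewrite /= !addr0 tpure0r addr0.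
Qed.

Lemma tens_ind (P : U ⊗ V -> Prop) :
  (forall u v, P (u ⊗ₜ v)) -> (forall x y, P x -> P y -> P (x + y)) ->
  forall x, P x.
Proof.
move=> Pp PD x; have [s ->] := tens_sum x.
by apply: big_ind => //; rewrite -(tpure0l 0); apply: Pp.
Qed.

Lemma tlift_family (Z W : lmodType k) (F : Z -> U -> V -> W) :
  (forall u v, linear (fun z => F z u v)) ->
  forall x, linear (fun z => tlift (F z) x).
Proof.
move=> lF x a z z'; rewrite /tlift /fsum scaler_sumr -big_split.
by apply: eq_bigr => p _; rewrite lF.
Qed.

End Universal.

Section TensorMaps.
Variable k : fieldType.
Implicit Types A B C D : lmodType k.

Definition tmap A B C D (f : {linear A -> C}) (g : {linear B -> D})
  : A ⊗ B -> C ⊗ D := tlift (fun a b => f a ⊗ₜ g b).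

Lemma tmap_bilinear A B C D (f : {linear A -> C}) (g : {linear B -> D}) :
  bilinear_for *:%R *:%R (fun a b => f a ⊗ₜ g b).
Proof.
split=> [b a x y|x a b b'] /=.
  by rewrite linearP tpureDl tpureZl.
by rewrite linearP tpureDr tpureZr.
Qed.

HB.instance Definition _ A B C D (f : {linear A -> C}) (g : {linear B -> D}) :=
  GRing.isLinear.Build k (A ⊗ B) (C ⊗ D) *:%R (tmap f g)
    (tlift_linear (tmap_bilinear f g)).

Lemma tmapE A B C D (f : {linear A -> C}) (g : {linear B -> D}) a b :
  tmap f g (a ⊗ₜ b) = f a ⊗ₜ g b.
Proof. exact: tliftE (tmap_bilinear f g). Qed.

Definition tassoc A B C : (A ⊗ B) ⊗ C -> A ⊗ (B ⊗ C) :=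
  tlift (fun x c => tlift (fun a b => a ⊗ₜ (b ⊗ₜ c)) x).

Definition tassoc_inv A B C : A ⊗ (B ⊗ C) -> (A ⊗ B) ⊗ C :=
  tlift (fun a y => tlift (fun b c => (a ⊗ₜ b) ⊗ₜ c) y).

(* (a (x) b) (x) (c (x) d) |-> (a (x) c) (x) (b (x) d) *)
Definition tinter A B C D : (A ⊗ B) ⊗ (C ⊗ D) -> (A ⊗ C) ⊗ (B ⊗ D) :=
  tlift (fun x y =>
    tlift (fun a b => tlift (fun c d => (a ⊗ₜ c) ⊗ₜ (b ⊗ₜ d)) y) x).

Let tp := (tpureDl, tpureDr, tpureZl, tpureZr).

Lemma tassoc_bilinear A B C :
  bilinear_for *:%R *:%R (fun (x : A ⊗ B) (c : C) =>
    tlift (fun a b => a ⊗ₜ (b ⊗ₜ c)) x).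
Proof.
split=> [c | x].
  by apply: tlift_linear; split=> [b|a'] a x y /=; rewrite !tp.
by apply: tlift_family => a b z c c'; rewrite !tp.
Qed.

Lemma tassoc_inv_bilinear A B C :
  bilinear_for *:%R *:%R (fun (a : A) (y : B ⊗ C) =>
    tlift (fun b c => (a ⊗ₜ b) ⊗ₜ c) y).
Proof.
split=> [y | a].
  by apply: tlift_family => b c z a a'; rewrite !tp.
by apply: tlift_linear; split=> [b|a'] a0 x y /=; rewrite !tp.
Qed.

Lemma tinter_bilinear0 A B C D (a : A) (b : B) :
  bilinear_for *:%R *:%R (fun (c : C) (d : D) => (a ⊗ₜ c) ⊗ₜ (b ⊗ₜ d)).
Proof. by split=> [d|c] z x y /=; rewrite !tp. Qed.

Lemma tinter_bilinear1 A B C D (y : C ⊗ D) :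
  bilinear_for *:%R *:%R (fun (a : A) (b : B) =>
    tlift (fun c d => (a ⊗ₜ c) ⊗ₜ (b ⊗ₜ d)) y).
Proof.
split=> [b|a].
  by apply: (tlift_family (F := fun a c d => (a ⊗ₜ c) ⊗ₜ (b ⊗ₜ d))) => c d z x x';
    rewrite !tp.
by apply: (tlift_family (F := fun b c d => (a ⊗ₜ c) ⊗ₜ (b ⊗ₜ d))) => c d z x x';
  rewrite !tp.
Qed.

Lemma tinter_bilinear A B C D :
  bilinear_for *:%R *:%R (fun (x : A ⊗ B) (y : C ⊗ D) =>
    tlift (fun a b => tlift (fun c d => (a ⊗ₜ c) ⊗ₜ (b ⊗ₜ d)) y) x).
Proof.
split=> [y|x].
  by apply: tlift_linear; apply: tinter_bilinear1.
apply: (tlift_family (F := fun y a b =>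
  tlift (fun c d => (a ⊗ₜ c) ⊗ₜ (b ⊗ₜ d)) y)) => a b.
by apply: tlift_linear; apply: tinter_bilinear0.
Qed.

HB.instance Definition _ A B C :=
  GRing.isLinear.Build k ((A ⊗ B) ⊗ C) (A ⊗ (B ⊗ C)) *:%R (@tassoc A B C)
    (tlift_linear (@tassoc_bilinear A B C)).

HB.instance Definition _ A B C :=
  GRing.isLinear.Build k (A ⊗ (B ⊗ C)) ((A ⊗ B) ⊗ C) *:%R (@tassoc_inv A B C)
    (tlift_linear (@tassoc_inv_bilinear A B C)).

HB.instance Definition _ A B C D :=
  GRing.isLinear.Build k ((A ⊗ B) ⊗ (C ⊗ D)) ((A ⊗ C) ⊗ (B ⊗ D)) *:%R
    (@tinter A B C D) (tlift_linear (@tinter_bilinear A B C D)).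

Lemma tassocE A B C (a : A) (b : B) (c : C) :
  tassoc ((a ⊗ₜ b) ⊗ₜ c) = a ⊗ₜ (b ⊗ₜ c).
Proof.
rewrite /tassoc tliftE; last exact: tassoc_bilinear.
by rewrite tliftE //; split=> [?|?] z x y /=; rewrite !tp.
Qed.

Lemma tassoc_invE A B C (a : A) (b : B) (c : C) :
  tassoc_inv (a ⊗ₜ (b ⊗ₜ c)) = (a ⊗ₜ b) ⊗ₜ c.
Proof.
rewrite /tassoc_inv tliftE; last exact: tassoc_inv_bilinear.
by rewrite tliftE //; split=> [?|?] z x y /=; rewrite !tp.
Qed.

Lemma tinterE A B C D (a : A) (b : B) (c : C) (d : D) :
  tinter ((a ⊗ₜ b) ⊗ₜ (c ⊗ₜ d)) = (a ⊗ₜ c) ⊗ₜ (b ⊗ₜ d).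
Proof.
rewrite /tinter tliftE; last exact: tinter_bilinear.
rewrite tliftE; last exact: tinter_bilinear1.
by rewrite tliftE //; apply: tinter_bilinear0.
Qed.

(* The canonical maps k (x) C -> C and C (x) k -> C, precomposed with
   e (x) id and id (x) e for a linear form e. *)
Definition tevl A C (e : {linear A -> k^o}) : A ⊗ C -> C :=
  tlift (fun x y => e x *: y).
Definition tevr A C (e : {linear A -> k^o}) : C ⊗ A -> C :=
  tlift (fun x y => e y *: x).

Lemma tevl_bilinear A C (e : {linear A -> k^o}) :
  bilinear_for *:%R *:%R (fun x (y : C) => e x *: y).
Proof.
split=> [c|x] z a b /=; first by rewrite linearP scalerDl scalerA.
by rewrite scalerDr !scalerA mulrC.
Qed.

Lemma tevr_bilinear A C (e : {linear A -> k^o}) :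
  bilinear_for *:%R *:%R (fun (x : C) y => e y *: x).
Proof. by have [h1 h2] := tevl_bilinear C e; split. Qed.

HB.instance Definition _ A C (e : {linear A -> k^o}) :=
  GRing.isLinear.Build k (A ⊗ C) C *:%R (tevl e)
    (tlift_linear (tevl_bilinear C e)).
HB.instance Definition _ A C (e : {linear A -> k^o}) :=
  GRing.isLinear.Build k (C ⊗ A) C *:%R (tevr e)
    (tlift_linear (tevr_bilinear C e)).

Lemma tevlE A C (e : {linear A -> k^o}) a (c : C) : tevl e (a ⊗ₜ c) = e a *: c.
Proof. exact: tliftE (tevl_bilinear C e). Qed.
Lemma tevrE A C (e : {linear A -> k^o}) a (c : C) : tevr e (c ⊗ₜ a) = e a *: c.
Proof. exact: tliftE (tevr_bilinear C e). Qed.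

Definition tmul (H : algType k) : H ⊗ H -> H := tlift *%R.

Lemma tmul_bilinear (H : algType k) : bilinear_for *:%R *:%R ( *%R : H -> H -> H).
Proof.
split=> [y|x] z a b /=; first by rewrite mulrDl scalerAl.
by rewrite mulrDr scalerAr.
Qed.

HB.instance Definition _ (H : algType k) :=
  GRing.isLinear.Build k (H ⊗ H) H *:%R (@tmul H)
    (tlift_linear (@tmul_bilinear H)).

Lemma tmulE (H : algType k) (x y : H) : tmul (x ⊗ₜ y) = x * y.
Proof. exact: tliftE (@tmul_bilinear H). Qed.

(* The multiplication of the tensor product algebra A (x) B. *)
Definition tens_mul (A B : algType k) (x y : A ⊗ B) : A ⊗ B :=
  tmap (@tmul A) (@tmul B) (tinter (x ⊗ₜ y)).

End TensorMaps.

HB.mixin Record isCoalgebra (k : fieldType) C of GRing.Lmodule k C := {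
  comul : {linear C -> C ⊗ C};
  counit : {linear C -> k^o};
  coassoc : forall c : C,
    tassoc (tmap comul idfun (comul c)) = tmap idfun comul (comul c);
  counitl : forall c : C, tevl counit (comul c) = c;
  counitr : forall c : C, tevr counit (comul c) = c
}.

#[short(type="coalgType")]
HB.structure Definition Coalgebra (k : fieldType) :=
  {C of isCoalgebra k C & GRing.Lmodule k C}.

Section TensorCoalgebra.
Variables (k : fieldType) (A B : coalgType k).

Definition tens_comul : {linear A ⊗ B -> (A ⊗ B) ⊗ (A ⊗ B)} :=
  @tinter k A A B B \o tmap (@comul k A) (@comul k B).

Lemma tens_counit_bilinear : bilinear_for *:%R *:%R
  (fun (a : A) (b : B) => counit a * counit b : k^o).
Proof.
split=> [b|a] z x y /=; rewrite linearP /=.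
  by rewrite mulrDl -mulrA.
by rewrite mulrDr mulrCA.
Qed.

Definition tens_counit : {linear A ⊗ B -> k^o} := tlift_lin tens_counit_bilinear.

Lemma tens_counitE a b : tens_counit (a ⊗ₜ b) = counit a * counit b.
Proof. exact: tliftE tens_counit_bilinear. Qed.

Lemma tens_comulE a b : tens_comul (a ⊗ₜ b) = tinter (comul a ⊗ₜ comul b).
Proof. by rewrite /= tmapE. Qed.

Let tD := (tpureDl, tpureDr, linearD).

Lemma tens_coassoc x :
  tassoc (tmap tens_comul idfun (tens_comul x)) =
  tmap idfun tens_comul (tens_comul x).
Proof.
elim/tens_ind: x => [a b|x y]; last first.
  by move=> ex ey; rewrite !linearD; congr (_ + _).
rewrite tens_comulE.
have natl (u : A ⊗ A) (v : B ⊗ B) :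
    tmap tens_comul idfun (tinter (u ⊗ₜ v)) =
    tmap (@tinter k A A B B) idfun
      (tinter (tmap comul idfun u ⊗ₜ tmap comul idfun v)).
  elim/tens_ind: u => [a1 a2|x y]; last first.
    by move=> ex ey; rewrite !tD; congr (_ + _).
  elim/tens_ind: v => [b1 b2|x y]; last first.
    by move=> ex ey; rewrite !tD; congr (_ + _).
  by rewrite !(tmapE, tinterE, tens_comulE).
have natr (u : A ⊗ A) (v : B ⊗ B) :
    tmap idfun tens_comul (tinter (u ⊗ₜ v)) =
    tmap idfun (@tinter k A A B B)
      (tinter (tmap idfun comul u ⊗ₜ tmap idfun comul v)).
  elim/tens_ind: u => [a1 a2|x y]; last first.
    by move=> ex ey; rewrite !tD; congr (_ + _).
  elim/tens_ind: v => [b1 b2|x y]; last first.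
    by move=> ex ey; rewrite !tD; congr (_ + _).
  by rewrite !(tmapE, tinterE, tens_comulE).
rewrite natl natr -!coassoc.
move: (tmap comul idfun (comul a)) (tmap comul idfun (comul b)) => u v.
elim/tens_ind: u => [u a3|x y]; last first.
  by move=> ex ey; rewrite !tD; congr (_ + _).
elim/tens_ind: v => [v b3|x y]; last first.
  by move=> ex ey; rewrite !tD; congr (_ + _).
elim/tens_ind: u => [a1 a2|x y]; last first.
  by move=> ex ey; rewrite !tD; congr (_ + _).
elim/tens_ind: v => [b1 b2|x y]; last first.
  by move=> ex ey; rewrite !tD; congr (_ + _).
by rewrite !(tmapE, tinterE, tassocE) /= !(tinterE, tassocE).
Qed.

Lemma tens_counitl x : tevl tens_counit (tens_comul x) = x.
Proof.
elim/tens_ind: x => [a b|x y]; last first.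
  by move=> ex ey; rewrite !linearD; congr (_ + _).
rewrite tens_comulE -{2}[a]counitl -{2}[b]counitl.
move: (comul a) (comul b) => u v.
elim/tens_ind: u => [a1 a2|x y]; last first.
  by move=> ex ey; rewrite !tD; congr (_ + _).
elim/tens_ind: v => [b1 b2|x y]; last first.
  by move=> ex ey; rewrite !tD; congr (_ + _).
by rewrite tinterE !tevlE tens_counitE tpureZl tpureZr scalerA.
Qed.

Lemma tens_counitr x : tevr tens_counit (tens_comul x) = x.
Proof.
elim/tens_ind: x => [a b|x y]; last first.
  by move=> ex ey; rewrite !linearD; congr (_ + _).
rewrite tens_comulE -{2}[a]counitr -{2}[b]counitr.
move: (comul a) (comul b) => u v.
elim/tens_ind: u => [a1 a2|x y]; last first.
  by move=> ex ey; rewrite !tD; congr (_ + _).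
elim/tens_ind: v => [b1 b2|x y]; last first.
  by move=> ex ey; rewrite !tD; congr (_ + _).
by rewrite tinterE !tevrE tens_counitE tpureZl tpureZr scalerA.
Qed.

HB.instance Definition _ :=
  isCoalgebra.Build k (A ⊗ B) tens_coassoc tens_counitl tens_counitr.

End TensorCoalgebra.

HB.mixin Record isHopf (k : fieldType) H
    of GRing.Algebra k H & Coalgebra k H := {
  comul1 : comul (1 : H) = 1 ⊗ₜ 1;
  comulM : forall x y : H, comul (x * y) = tens_mul (comul x) (comul y);
  counit1 : counit (1 : H) = 1;
  counitM : forall x y : H, counit (x * y) = counit x * counit y;
  antipode : {linear H -> H};
  antipodel : forall x : H,
    tmul (tmap antipode idfun (comul x)) = counit x *: 1;
  antipoder : forall x : H,
    tmul (tmap idfun antipode (comul x)) = counit x *: 1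
}.

#[short(type="hopfType")]
HB.structure Definition Hopf (k : fieldType) :=
  {H of isHopf k H & GRing.Algebra k H & Coalgebra k H}.

Section Braidings.
Variable k : fieldType.

Definition coalgebra_morphism (C D : coalgType k) (f : {linear C -> D}) : Prop :=
  (forall c, comul (f c) = tmap f f (comul c)) /\
  (forall c, counit (f c) = counit c).

Definition left_module_coalgebra (H : hopfType k) (C : coalgType k)
    (act : {linear H ⊗ C -> C}) : Prop :=
  [/\ forall c, act (1 ⊗ₜ c) = c,
      forall h l c, act ((h * l) ⊗ₜ c) = act (h ⊗ₜ act (l ⊗ₜ c)) &
      coalgebra_morphism act].

Definition right_module_coalgebra (H : hopfType k) (C : coalgType k)
    (act : {linear C ⊗ H -> C}) : Prop :=
  [/\ forall c, act (c ⊗ₜ 1) = c,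
      forall c h l, act (c ⊗ₜ (h * l)) = act (act (c ⊗ₜ h) ⊗ₜ l) &
      coalgebra_morphism act].

(* Triple tensor powers are bracketed to the left, so s (x) V is literally
   [tmap s idfun] and V (x) s is conjugated by the associator. *)
Section BraidEquation.
Variables (V : lmodType k) (s : {linear V ⊗ V -> V ⊗ V}).

Definition s12 : {linear (V ⊗ V) ⊗ V -> (V ⊗ V) ⊗ V} := tmap s idfun.

Definition s23 : {linear (V ⊗ V) ⊗ V -> (V ⊗ V) ⊗ V} :=
  @tassoc_inv k V V V \o (tmap idfun s \o @tassoc k V V V).

Definition braid_equation : Prop :=
  s12 \o s23 \o s12 =1 s23 \o s12 \o s23.
End BraidEquation.

Definition set_theoretic_type_solution (C : coalgType k)
    (s : {linear C ⊗ C -> C ⊗ C}) : Prop :=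
  braid_equation s /\ coalgebra_morphism s.

(* The last two clauses are s (eta (x) H) = H (x) eta and
   s (H (x) eta) = eta (x) H under k (x) H = H = H (x) k. *)
Definition weak_braiding_operator (H : hopfType k)
    (s : {linear H ⊗ H -> H ⊗ H}) : Prop :=
  [/\ set_theoretic_type_solution s,
      s \o tmap (@tmul k H) idfun =1
        tmap idfun (@tmul k H) \o @tassoc k H H H \o s12 s \o s23 s,
      s \o tmap idfun (@tmul k H) \o @tassoc k H H H =1
        tmap (@tmul k H) idfun \o s23 s \o s12 s,
      forall h, s (1 ⊗ₜ h) = h ⊗ₜ 1 &
      forall h, s (h ⊗ₜ 1) = 1 ⊗ₜ h].

Definition braiding_operator (H : hopfType k)
    (s : {linear H ⊗ H -> H ⊗ H}) : Prop :=
  weak_braiding_operator s /\ @tmul k H =1 @tmul k H \o s.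

End Braidings.

(* Main.v *)
Require Import Defs.
From HB Require Import structures.
From mathcomp Require Import all_boot all_order all_algebra.
From mathcomp Require Import boolp.

Set Implicit Arguments.
Unset Strict Implicit.
Unset Printing Implicit Defensive.

Import GRing.Theory.
Local Open Scope ring_scope.

(** Write [h . l] for the left action s1 and [h ^ l] for the right action s2.
The proof follows the set-theoretic one (for a group acting on itself from
both sides, with h l = (h . l)(h ^ l)), once Sweedler sums are replaced by
point-free identities between linear maps.  The pairing <f, g> = (f (x) g) Delta
plays the part of the map d |-> (f d, g d); it behaves like a cartesian
pairing when it is composed with coalgebra morphisms, which are determined by
their components ([cmor_ext]).  Convolution of maps into H is mu <f, g>, and a
coalgebra morphism into H is convolution invertible, its inverse being its
composite with the antipode.

Coalgebra morphism.  The product of s1 and s2 is mu, which is a coalgebra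
morphism; writing Delta (s1 * s2) in two ways and cancelling the outer factors
shows that the components of s may be exchanged, <s1, s2> = swap <s2, s1>
([pair_comm]).  This exchange law is exactly what makes s a coalgebra morphism
([cmor_pair]).

Compatibility of the actions with mu.  From h (l m) = (h l) m, expanded through
s1 * s2 = mu on both sides, one cancels the factor that the module axioms
already identify and gets h . (l m) = (h1 . l1) ((h2 ^ l2) . m) and
(h l) ^ m = (h ^ (l1 . m1)) (l2 ^ m2) ([s1_mulr], [s2_mull]).  These are the
components of the two compatibilities of s with mu ([s_mulr], [s_mull]) that
are not already module axioms.

Braid equation.  The two sides are coalgebra endomorphisms of H (x) H (x) H.
Their outer components agree by the module axioms, their total products agree
since mu s = mu, and so the middle components agree by cancellation
([s_braid]).

Bijectivity.  The antipode need not be bijective, so the inverse cannot be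
obtained by conjugating s with it.  Instead s = swap Theta Phi where
Phi (h (x) l) = h1 (x) (h2 . l) and Theta (h (x) u) = psi (h (x) u1) (x) u2, for
psi = s2 Phi^-1.  Such shears along a module structure are invertible, the
inverse being the shear along the antipode ([lshear_comp], [rshear_comp]); Phi
is one because s1 is an action, and Theta is one because psi is a right action
of H on itself ([psiA]).  For groups, psi (h, u) = ((h^-1) ^ u)^-1. *)

(** * The category of coalgebras and linear maps *)

Section CoalgebraMaps.
Variable k : fieldType.
Implicit Types A B C D : coalgType k.

(** Naming the tensor product coalgebra and the type of linear maps between
coalgebras keeps every object presented as a coalgebra, so that two composites
are compared through the names of their objects and not through the algebraic
structures underlying them. *)
Definition ctens A B : coalgType k := (A ⊗ B)%type.
Definition lin C D : Type := {linear C -> D}.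

End CoalgebraMaps.
Notation "A ⨂ B" := (ctens A B) (at level 40, left associativity).
Notation "C ⟶ D" := (lin C D) (at level 70).

Section Operations.
Variable k : fieldType.
Implicit Types A B C D : coalgType k.

Definition lid C : C ⟶ C := (idfun : {linear C -> C}).
Definition lcomp C D E (f : D ⟶ E) (g : C ⟶ D) : C ⟶ E :=
  (f : {linear D -> E}) \o (g : {linear C -> D}).
Definition tm A B C D (f : A ⟶ C) (g : B ⟶ D) : A ⨂ B ⟶ C ⨂ D :=
  (tmap (f : {linear A -> C}) (g : {linear B -> D}) : {linear A ⊗ B -> C ⊗ D}).
Definition assoc A B C : A ⨂ B ⨂ C ⟶ A ⨂ (B ⨂ C) :=
  (@tassoc k A B C : {linear _ -> _}).
Definition assocI A B C : A ⨂ (B ⨂ C) ⟶ A ⨂ B ⨂ C :=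
  (@tassoc_inv k A B C : {linear _ -> _}).
Definition inter A B C D : (A ⨂ B) ⨂ (C ⨂ D) ⟶ (A ⨂ C) ⨂ (B ⨂ D) :=
  (@tinter k A B C D : {linear _ -> _}).
Definition cop C : C ⟶ C ⨂ C := (comul : {linear C -> C ⊗ C}).
Definition pr1 A B : A ⨂ B ⟶ A := (tevr counit : {linear A ⊗ B -> A}).
Definition pr2 A B : A ⨂ B ⟶ B := (tevl counit : {linear A ⊗ B -> B}).

Lemma swap_bilinear A B :
  bilinear_for *:%R *:%R (fun (a : A) (b : B) => b ⊗ₜ a).
Proof.
by split=> [b|a] c x y; rewrite !(tpureDl, tpureDr, tpureZl, tpureZr).
Qed.
Definition swap A B : A ⨂ B ⟶ B ⨂ A := tlift_lin (@swap_bilinear A B).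

Definition insl A B (a : A) : B ⟶ A ⨂ B :=
  HB.pack_for {linear B -> A ⊗ B} (fun b : B => a ⊗ₜ b)
    (GRing.isLinear.Build k _ _ _ _ ((@tpure_bilinear k A B).2 a)).
Definition insr A B (b : B) : A ⟶ A ⨂ B :=
  HB.pack_for {linear A -> A ⊗ B} (fun a : A => a ⊗ₜ b)
    (GRing.isLinear.Build k _ _ _ _ ((@tpure_bilinear k A B).1 b)).

Variable H : hopfType k.

Definition mu : H ⨂ H ⟶ H := (@tmul k H : {linear H ⊗ H -> H}).
Definition anti : H ⟶ H := (antipode : {linear H -> H}).

Lemma eta_eps_linear C : linear (fun c : C => ((counit c : k) *: (1 : H))).
Proof. by move=> a x y; rewrite linearP /= scalerDl scalerA. Qed.
(** The unit of the convolution algebra of maps from [C] to [H]. *)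
Definition eta_eps C : C ⟶ H :=
  HB.pack_for {linear C -> H} (fun c : C => ((counit c : k) *: (1 : H)))
    (GRing.isLinear.Build k _ _ _ _ (@eta_eps_linear C)).

End Operations.

Arguments lid {k C}.
Arguments assoc {k A B C}.
Arguments assocI {k A B C}.
Arguments inter {k A B C D}.
Arguments swap {k A B}.
Arguments cop {k C}.
Arguments pr1 {k A B}.
Arguments pr2 {k A B}.
Arguments mu {k H}.
Arguments anti {k H}.
Arguments eta_eps {k H C}.
Notation "f ∘ g" := (lcomp f g) (at level 40, left associativity).
Notation "f ⊠ g" := (tm f g) (at level 38, left associativity).

(** The coalgebraic pairing.  It is locked because it is itself a composite, and
rewriting with associativity of composition would otherwise see through it. *)
HB.lock Definition pair (k : fieldType) (D A B : coalgType k)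
  (f : D ⟶ A) (g : D ⟶ B) : D ⟶ A ⨂ B := (f ⊠ g) ∘ cop.
Notation "⟨ f , g ⟩" := (pair f g) (at level 0, f, g at level 99).
Notation "f ⋆ g" := (mu ∘ ⟨f, g⟩) (at level 39, left associativity).

(** * Linear maps on tensor products *)

Section Laws.
Variable k : fieldType.
Implicit Types A B C D E : coalgType k.

Lemma lin_ext C D (f g : C ⟶ D) : f =1 g -> f = g.
Proof.
case: f g => f [[f1] [f2]] [g [[g1] [g2]]] /= /funext E; subst g.
by rewrite (Prop_irrelevance f1 g1) (Prop_irrelevance f2 g2).
Qed.

Lemma lcompE C D E (f : D ⟶ E) (g : C ⟶ D) x : (f ∘ g) x = f (g x).
Proof. by []. Qed.
Lemma lidE C (x : C) : lid x = x.
Proof. by []. Qed.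
Lemma tmE A B C D (f : A ⟶ C) (g : B ⟶ D) a b :
  (f ⊠ g) (a ⊗ₜ b) = f a ⊗ₜ g b.
Proof. exact: tmapE. Qed.
Lemma assocE A B C (a : A) (b : B) (c : C) :
  assoc ((a ⊗ₜ b) ⊗ₜ c) = a ⊗ₜ (b ⊗ₜ c).
Proof. exact: tassocE. Qed.
Lemma assocIE A B C (a : A) (b : B) (c : C) :
  assocI (a ⊗ₜ (b ⊗ₜ c)) = (a ⊗ₜ b) ⊗ₜ c.
Proof. exact: tassoc_invE. Qed.
Lemma interE A B C D (a : A) (b : B) (c : C) (d : D) :
  inter ((a ⊗ₜ b) ⊗ₜ (c ⊗ₜ d)) = (a ⊗ₜ c) ⊗ₜ (b ⊗ₜ d).
Proof. exact: tinterE. Qed.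
Lemma swapE A B (a : A) (b : B) : swap (a ⊗ₜ b) = b ⊗ₜ a.
Proof. exact: tliftE (@swap_bilinear k A B). Qed.
Lemma pr1E A B (a : A) (b : B) : pr1 (a ⊗ₜ b) = (counit b : k) *: a.
Proof. exact: tevrE. Qed.
Lemma pr2E A B (a : A) (b : B) : pr2 (a ⊗ₜ b) = (counit a : k) *: b.
Proof. exact: tevlE. Qed.
Lemma eta_epsE (H : hopfType k) C (c : C) : eta_eps c = (counit c : k) *: (1 :
  H).
Proof. by []. Qed.
Lemma muE (H : hopfType k) (a b : H) : mu (a ⊗ₜ b) = a * b.
Proof. exact: tmulE. Qed.
Lemma inslE A B (a : A) (b : B) : insl B a b = a ⊗ₜ b.
Proof. by []. Qed.
Lemma insrE A B (a : A) (b : B) : insr A b a = a ⊗ₜ b.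
Proof. by []. Qed.

Definition tE := (tmE, assocE, assocIE, interE, swapE, lcompE, lidE).

Lemma lcompA A B C D (f : C ⟶ D) (g : B ⟶ C) (h : A ⟶ B) :
  f ∘ (g ∘ h) = (f ∘ g) ∘ h.
Proof. exact: lin_ext. Qed.
Lemma lcompf1 C D (f : C ⟶ D) : f ∘ lid = f.
Proof. exact: lin_ext. Qed.
Lemma lcomp1f C D (f : C ⟶ D) : lid ∘ f = f.
Proof. exact: lin_ext. Qed.

Lemma tens_ext2 A B C (F G : A ⨂ B ⟶ C) :
  (forall a b, F (a ⊗ₜ b) = G (a ⊗ₜ b)) -> F = G.
Proof. by move=> FG; apply: lin_ext => x; apply: (tens_ext FG). Qed.

Lemma tens_ext3 A B C D (F G : A ⨂ B ⨂ C ⟶ D) :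
  (forall a b c, F (a ⊗ₜ b ⊗ₜ c) = G (a ⊗ₜ b ⊗ₜ c)) -> F = G.
Proof.
move=> FG; apply: tens_ext2 => x c.
have := tens_ext (F := F \o insr (A ⨂ B) c) (G := G \o insr (A ⨂ B) c).
by apply=> a b; apply: FG.
Qed.

Lemma tens_ext3r A B C D (F G : A ⨂ (B ⨂ C) ⟶ D) :
  (forall a b c, F (a ⊗ₜ (b ⊗ₜ c)) = G (a ⊗ₜ (b ⊗ₜ c))) -> F = G.
Proof.
move=> FG; apply: tens_ext2 => a x.
have := tens_ext (F := F \o insl (B ⨂ C) a) (G := G \o insl (B ⨂ C) a).
by apply=> b c; apply: FG.
Qed.

Lemma tens_ext4 A B C D E (F G : (A ⨂ B) ⨂ (C ⨂ D) ⟶ E) :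
  (forall a b c d,
     F (a ⊗ₜ b ⊗ₜ (c ⊗ₜ d)) = G (a ⊗ₜ b ⊗ₜ (c ⊗ₜ d))) -> F = G.
Proof.
move=> FG; apply: tens_ext3 => a b x.
have := tens_ext (F := F \o insl (C ⨂ D) (a ⊗ₜ b : A ⨂ B))
                 (G := G \o insl (C ⨂ D) (a ⊗ₜ b : A ⨂ B)).
by apply=> c d; apply: FG.
Qed.

Lemma tm_comp A B C D A' B' (f : A ⟶ C) (g : B ⟶ D) (f' : A' ⟶ A) (g' : B' ⟶ B)
  :
  (f ⊠ g) ∘ (f' ⊠ g') = (f ∘ f') ⊠ (g ∘ g').
Proof. by apply: tens_ext2 => a b; rewrite !tE. Qed.

Lemma tm1 A B : lid ⊠ lid = lid :> (A ⨂ B ⟶ A ⨂ B).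
Proof. by apply: tens_ext2 => a b; rewrite !tE. Qed.

Lemma assocK A B C : assocI ∘ assoc = lid :> (A ⨂ B ⨂ C ⟶ _).
Proof. by apply: tens_ext3 => a b c; rewrite !tE. Qed.
Lemma assocIK A B C : assoc ∘ assocI = lid :> (A ⨂ (B ⨂ C) ⟶ _).
Proof. by apply: tens_ext3r => a b c; rewrite !tE. Qed.
Lemma swapK A B : swap ∘ swap = lid :> (A ⨂ B ⟶ _).
Proof. by apply: tens_ext2 => a b; rewrite !tE. Qed.

Lemma assoc_tm A B C A' B' C' (f : A ⟶ A') (g : B ⟶ B') (h : C ⟶ C') :
  assoc ∘ (f ⊠ g ⊠ h) = (f ⊠ (g ⊠ h)) ∘ assoc.
Proof. by apply: tens_ext3 => a b c; rewrite !tE. Qed.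
Lemma inter_tm A B C D A' B' C' D' (f : A ⟶ A') (g : B ⟶ B')
  (h : C ⟶ C') (i : D ⟶ D') :
  inter ∘ ((f ⊠ g) ⊠ (h ⊠ i)) = ((f ⊠ h) ⊠ (g ⊠ i)) ∘ inter.
Proof. by apply: tens_ext4 => a b c d; rewrite !tE. Qed.

End Laws.

(** * Pairings and coalgebra morphisms *)

Section CoalgebraLaws.
Variable k : fieldType.
Implicit Types A B C D E : coalgType k.

Lemma coassocE C : assoc ∘ (cop ⊠ lid) ∘ cop = (lid ⊠ cop) ∘ cop :> (C ⟶ _).
Proof. by apply: lin_ext => c; apply: coassoc. Qed.
Lemma pr1_cop C : pr1 ∘ cop = lid :> (C ⟶ C).
Proof. by apply: lin_ext => c; apply: counitr. Qed.
Lemma pr2_cop C : pr2 ∘ cop = lid :> (C ⟶ C).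
Proof. by apply: lin_ext => c; apply: counitl. Qed.

Lemma cop_tens A B : cop = inter ∘ (cop ⊠ cop) :> (A ⨂ B ⟶ _).
Proof. exact: lin_ext. Qed.
Lemma counit_tens A B (a : A) (b : B) :
  counit (a ⊗ₜ b : A ⨂ B) = counit a * counit b :> k.
Proof. exact: tens_counitE. Qed.

Lemma pairE A B D (f : D ⟶ A) (g : D ⟶ B) : ⟨f, g⟩ = (f ⊠ g) ∘ cop.
Proof. by rewrite unlock. Qed.

Lemma tm_pair A B A' B' D (a : A ⟶ A') (b : B ⟶ B') (f : D ⟶ A) (g : D ⟶ B) :
  (a ⊠ b) ∘ ⟨f, g⟩ = ⟨a ∘ f, b ∘ g⟩.
Proof. by rewrite !pairE lcompA tm_comp. Qed.

(** Coassociativity, in the form in which it is used throughout. *)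
Lemma pairA A B C D (f : D ⟶ A) (g : D ⟶ B) (h : D ⟶ C) :
  assoc ∘ ⟨⟨f, g⟩, h⟩ = ⟨f, ⟨g, h⟩⟩.
Proof.
have -> : ⟨⟨f, g⟩, h⟩ = (f ⊠ g ⊠ h) ∘ ((cop ⊠ lid) ∘ cop).
  by rewrite !pairE [RHS]lcompA tm_comp lcompf1.
rewrite [LHS]lcompA assoc_tm -[LHS]lcompA [assoc ∘ _]lcompA coassocE
  [LHS]lcompA.
by rewrite tm_comp lcompf1 !pairE.
Qed.

Lemma pairAI A B C D (f : D ⟶ A) (g : D ⟶ B) (h : D ⟶ C) :
  assocI ∘ ⟨f, ⟨g, h⟩⟩ = ⟨⟨f, g⟩, h⟩.
Proof. by rewrite -pairA lcompA assocK lcomp1f. Qed.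

Definition cmor C D (f : C ⟶ D) : Prop :=
  cop ∘ f = ⟨f, f⟩ /\ forall c, counit (f c) = counit c.

Lemma cmorP C D (f : C ⟶ D) :
  coalgebra_morphism (f : {linear C -> D}) <-> cmor f.
Proof.
split=> [[E1 E2]|[E1 E2]]; split=> //.
  by apply: lin_ext => x; rewrite pairE; apply: E1.
by move=> x; rewrite -[LHS]/((cop ∘ f) x) E1 pairE.
Qed.

Lemma pr1_tm A B C D (f : A ⟶ C) (g : B ⟶ D) : cmor g ->
  pr1 ∘ (f ⊠ g) = f ∘ pr1.
Proof.
by case=> _ Eg; apply: tens_ext2 => a b;
  rewrite !tE !pr1E Eg -[RHS]/(f _) linearZ.
Qed.

Lemma pr2_tm A B C D (f : A ⟶ C) (g : B ⟶ D) : cmor f ->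
  pr2 ∘ (f ⊠ g) = g ∘ pr2.
Proof.
by case=> _ Ef; apply: tens_ext2 => a b;
  rewrite !tE !pr2E Ef -[RHS]/(g _) linearZ.
Qed.

Lemma pr1_pair A B D (f : D ⟶ A) (g : D ⟶ B) : cmor g -> pr1 ∘ ⟨f, g⟩ = f.
Proof.
by move=> mg; rewrite pairE lcompA pr1_tm // -lcompA pr1_cop lcompf1.
Qed.
Lemma pr2_pair A B D (f : D ⟶ A) (g : D ⟶ B) : cmor f -> pr2 ∘ ⟨f, g⟩ = g.
Proof.
by move=> mf; rewrite pairE lcompA pr2_tm // -lcompA pr2_cop lcompf1.
Qed.

(** The comultiplication of a tensor product interleaves the two factors, so
that projecting its halves to different factors only involves the counits. *)
Lemma pair_pr A B : ⟨pr1, pr2⟩ = lid :> (A ⨂ B ⟶ _).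
Proof.
have E : (pr1 ⊠ pr2) ∘ inter = pr1 ⊠ pr2 :> ((A ⨂ A) ⨂ (B ⨂ B) ⟶ _).
  apply: tens_ext4 => a b c d; rewrite !tE !pr1E !pr2E.
  by rewrite !(tpureZl, tpureZr) !scalerA mulrC.
by rewrite pairE cop_tens lcompA E tm_comp pr1_cop pr2_cop tm1.
Qed.

Lemma pair_comp A B C D (f : D ⟶ A) (g : D ⟶ B) (F : C ⟶ D) :
  cmor F -> ⟨f, g⟩ ∘ F = ⟨f ∘ F, g ∘ F⟩.
Proof. by case=> EF _; rewrite {1}pairE -lcompA EF tm_pair. Qed.

Lemma tm_pairE A B C D (a : A ⟶ C) (b : B ⟶ D) : a ⊠ b = ⟨a ∘ pr1, b ∘ pr2⟩.
Proof. by rewrite -tm_pair pair_pr lcompf1. Qed.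

Lemma cmor_lid C : cmor (lid : C ⟶ C).
Proof. by split=> //; rewrite pairE tm1 lcomp1f lcompf1. Qed.

Lemma cmor_comp C D E (f : D ⟶ E) (g : C ⟶ D) : cmor f -> cmor g ->
  cmor (f ∘ g).
Proof.
move=> [E1 E2] mg; split=> [|c]; first by rewrite lcompA E1 pair_comp.
by rewrite lcompE E2; case: mg => _ ->.
Qed.

(** Counits take values in [k], which is not one of the objects at hand, so
equalities of linear forms on a tensor product are reduced to pure tensors
separately. *)
Lemma counit_ext A B C (F : A ⨂ B ⟶ C) :
  (forall a b, counit (F (a ⊗ₜ b)) = counit a * counit b :> k) ->
  forall x, counit (F x) = counit x.
Proof.
move=> E; apply: (tens_ext (F := counit \o F) (G := tens_counit A B)) => a b.
by rewrite tens_counitE; apply: E.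
Qed.

Lemma cmor_tm A B C D (f : A ⟶ C) (g : B ⟶ D) : cmor f -> cmor g ->
  cmor (f ⊠ g).
Proof.
move=> [f1 f2] [g1 g2]; split.
  rewrite !cop_tens -lcompA tm_comp f1 g1 !pairE cop_tens -tm_comp !lcompA.
  by rewrite inter_tm.
by apply: counit_ext => a b; rewrite tmE counit_tens f2 g2.
Qed.

Lemma cmor_inv C D (f : C ⟶ D) (g : D ⟶ C) :
  f ∘ g = lid -> g ∘ f = lid -> cmor f -> cmor g.
Proof.
move=> fg gf mf; split; last first.
  by move=> c; case: mf => _ <-; rewrite -lcompE fg.
rewrite -[LHS]lcomp1f -tm1 -gf -tm_comp -lcompA [_ ∘ (cop ∘ g)]lcompA.
case: (mf) => E _; rewrite pairE in E.
by rewrite -E -[cop ∘ f ∘ g]lcompA fg lcompf1 pairE.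
Qed.

Lemma cmor_assoc A B C : cmor (assoc : A ⨂ B ⨂ C ⟶ _).
Proof.
split; last first.
  apply: counit_ext => x c; rewrite -[counit x]/(tens_counit A B x).
  elim/tens_ind: x => [a b|x y ex ey].
    by rewrite assocE !counit_tens mulrA.
  by rewrite tpureDl !linearD mulrDl ex ey.
apply: tens_ext3 => a b c; rewrite pairE !(cop_tens, tE).
move: (cop a) (cop b) (cop c) => x y z.
elim/tens_ind: x => [? ?|? ? ex ey]; last first.
  by rewrite !(tpureDl, tpureDr, linearD) /= ex ey.
elim/tens_ind: y => [? ?|? ? ex ey]; last first.
  by rewrite !(tpureDl, tpureDr, linearD) /= ex ey.
elim/tens_ind: z => [? ?|? ? ex ey]; last first.
  by rewrite !(tpureDl, tpureDr, linearD) /= ex ey.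
by rewrite !tE.
Qed.

Lemma cmor_assocI A B C : cmor (assocI : A ⨂ (B ⨂ C) ⟶ _).
Proof. exact: cmor_inv (assocIK A B C) (assocK A B C) (cmor_assoc A B C). Qed.

Lemma cmor_pr1 A B : cmor (pr1 : A ⨂ B ⟶ A).
Proof.
split; last first.
  by apply: counit_ext => a b; rewrite pr1E linearZ /= mulrC.
rewrite pairE cop_tens lcompA.
have -> : pr1 ⊠ pr1 ∘ inter = pr1 ∘ (lid ⊠ (pr1 : B ⨂ B ⟶ B))
            :> (A ⨂ A ⨂ (B ⨂ B) ⟶ _).
  apply: tens_ext4 => a b c d; rewrite !tE !pr1E.
  by rewrite tpureZl tpureZr scalerA linearZ /= mulrC.
rewrite -lcompA tm_comp lcomp1f pr1_cop.
by apply: tens_ext2 => a b; rewrite !tE !pr1E linearZ.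
Qed.

Lemma cmor_pr2 A B : cmor (pr2 : A ⨂ B ⟶ B).
Proof.
split; last first.
  by apply: counit_ext => a b; rewrite pr2E linearZ.
rewrite pairE cop_tens lcompA.
have -> : pr2 ⊠ pr2 ∘ inter = pr2 ∘ ((pr2 : A ⨂ A ⟶ A) ⊠ lid)
            :> (A ⨂ A ⨂ (B ⨂ B) ⟶ _).
  apply: tens_ext4 => a b c d; rewrite !tE !pr2E.
  by rewrite tpureZl tpureZr scalerA linearZ.
rewrite -lcompA tm_comp lcomp1f pr2_cop.
by apply: tens_ext2 => a b; rewrite !tE !pr2E linearZ.
Qed.

(** Unlike in a cartesian category, uniqueness of pairings holds only for
comultiplicative maps. *)
Lemma cmor_eta A B D (F : D ⟶ A ⨂ B) : cmor F -> ⟨pr1 ∘ F, pr2 ∘ F⟩ = F.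
Proof. by move=> mF; rewrite -pair_comp // pair_pr lcomp1f. Qed.

Lemma cmor_ext A B D (F G : D ⟶ A ⨂ B) : cmor F -> cmor G ->
  pr1 ∘ F = pr1 ∘ G -> pr2 ∘ F = pr2 ∘ G -> F = G.
Proof. by move=> mF mG E1 E2; rewrite -(cmor_eta mF) E1 E2 cmor_eta. Qed.

(** The comultiplication sends [<f, g>] to f1 (x) g3 (x) f2 (x) g4 in Sweedler
indices, while [<f, g>] taken twice gives f1 (x) g2 (x) f3 (x) g4: the two
differ by an exchange of the middle factors. *)
Lemma cmor_pair A B D (f : D ⟶ A) (g : D ⟶ B) :
  cmor f -> cmor g -> ⟨f, g⟩ = swap ∘ ⟨g, f⟩ -> cmor ⟨f, g⟩.
Proof.
move=> mf mg fg; split; last first.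
  by move=> d; case: (cmor_pr1 A B) => _ <-; rewrite -lcompE pr1_pair //;
    case: mf.
case: (mf) (mg) => [cf _] [cg _].
have -> : cop ∘ ⟨f, g⟩ = inter ∘ ⟨⟨f, f⟩, ⟨g, g⟩⟩.
  by rewrite cop_tens -lcompA tm_pair cf cg.
(* [J] redistributes the three entries f, (a, b), g as (f, b), (a, g). *)
pose J : A ⨂ ((A ⨂ B) ⨂ B) ⟶ A ⨂ B ⨂ (A ⨂ B) :=
  assocI ∘ (lid ⊠ (assoc ∘ (swap ⊠ lid))).
have -> : inter ∘ ⟨⟨f, f⟩, ⟨g, g⟩⟩ = J ∘ ⟨f, ⟨⟨f, g⟩, g⟩⟩.
  have -> : inter = J ∘ (lid ⊠ assocI) ∘ assoc.
    by apply: tens_ext4 => a b c d; rewrite !tE.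
  by rewrite -!lcompA pairA tm_pair pairAI lcomp1f.
rewrite -[RHS]pairAI /J -[LHS]lcompA tm_pair lcomp1f -[_ ∘ ⟨_, g⟩]lcompA
  tm_pair.
by rewrite lcomp1f {1}fg lcompA swapK lcomp1f pairA.
Qed.

End CoalgebraLaws.

(** * Actions and shears *)

Section Units.
Variables (k : fieldType) (H : hopfType k) (D : coalgType k).

Lemma pair_eta_eps (A : coalgType k) (x : D ⟶ A) :
  ⟨x, eta_eps⟩ = insr A (1 : H) ∘ x.
Proof.
rewrite pairE -[x in RHS]lcompf1 -pr1_cop !lcompA; congr (_ ∘ cop).
apply: tens_ext2 => a b.
by rewrite tmE eta_epsE !lcompE insrE pr1E linearZ /= tpureZr tpureZl.
Qed.

Lemma eta_eps_pair (A : coalgType k) (x : D ⟶ A) :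
  ⟨eta_eps, x⟩ = insl A (1 : H) ∘ x.
Proof.
rewrite pairE -[x in RHS]lcompf1 -pr2_cop !lcompA; congr (_ ∘ cop).
apply: tens_ext2 => a b.
by rewrite tmE eta_epsE !lcompE inslE pr2E linearZ /= tpureZr tpureZl.
Qed.

Lemma pr1_insr : pr1 ∘ insr D (1 : H) = lid.
Proof. by apply: lin_ext => x; rewrite lcompE insrE pr1E counit1 scale1r. Qed.

Lemma counit_eta_eps (d : D) : counit (eta_eps d : H) = counit d.
Proof. by rewrite eta_epsE linearZ /= counit1; apply: mulr1. Qed.

Lemma cmor_eta_eps : cmor (eta_eps : D ⟶ H).
Proof.
split; last exact: counit_eta_eps.
rewrite pair_eta_eps; apply: lin_ext => x.
by rewrite [LHS]lcompE [RHS]lcompE !eta_epsE !linearZ; congr (_ *: _);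
  apply: comul1.
Qed.

Lemma cmor_insr : cmor (insr D (1 : H)).
Proof.
rewrite -[insr _ _]lcompf1 -pair_eta_eps.
apply: cmor_pair; [exact: cmor_lid | exact: cmor_eta_eps |].
rewrite pair_eta_eps eta_eps_pair.
by apply: lin_ext => x; rewrite !lcompE inslE swapE.
Qed.

Lemma cmor_insl : cmor (insl D (1 : H)).
Proof.
rewrite -[insl _ _]lcompf1 -eta_eps_pair.
apply: cmor_pair; [exact: cmor_eta_eps | exact: cmor_lid |].
rewrite pair_eta_eps eta_eps_pair.
by apply: lin_ext => x; rewrite !lcompE insrE swapE.
Qed.

End Units.

Section LeftAction.
Variables (k : fieldType) (H : hopfType k) (V : coalgType k) (act : H ⨂ V ⟶ V).
Hypothesis actA : act ∘ (mu ⊠ lid) = act ∘ (lid ⊠ act) ∘ assoc.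
Hypothesis act1 : act ∘ insl V 1 = lid.
Implicit Types D E : coalgType k.

Lemma lact_conv D (f g : D ⟶ H) (x : D ⟶ V) :
  act ∘ ⟨f ⋆ g, x⟩ = act ∘ ⟨f, act ∘ ⟨g, x⟩⟩.
Proof.
have -> : ⟨f ⋆ g, x⟩ = (mu ⊠ lid) ∘ ⟨⟨f, g⟩, x⟩ by rewrite tm_pair lcomp1f.
by rewrite lcompA actA -!lcompA pairA tm_pair lcomp1f.
Qed.

Lemma lact_unit D (x : D ⟶ V) : act ∘ ⟨eta_eps, x⟩ = x.
Proof. by rewrite eta_eps_pair lcompA act1 lcomp1f. Qed.

(** The map d (x) v |-> d1 (x) f(d2) v. It turns convolution of [f] into
composition, hence is invertible as soon as [f] is convolution invertible. *)
Definition lshear D (f : D ⟶ H) : D ⨂ V ⟶ D ⨂ V :=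
  (lid ⊠ (act ∘ (f ⊠ lid))) ∘ (assoc ∘ (cop ⊠ lid)).

(** As [x] is an arbitrary linear map, this lets shears, which are not coalgebra
morphisms, be composed with one another. *)
Lemma lshear_pair D E (f : D ⟶ H) (d : E ⟶ D) (x : E ⟶ V) :
  cmor d -> lshear f ∘ ⟨d, x⟩ = ⟨d, act ∘ ⟨f ∘ d, x⟩⟩.
Proof.
case=> cd _; rewrite /lshear -lcompA -[_ ∘ ⟨d, x⟩]lcompA tm_pair cd pairA.
by rewrite tm_pair -[act ∘ _ ∘ _]lcompA tm_pair !lcomp1f.
Qed.

Lemma lshearE D (f : D ⟶ H) : lshear f = ⟨pr1, act ∘ ⟨f ∘ pr1, pr2⟩⟩.
Proof. by rewrite -lshear_pair ?pair_pr ?lcompf1 //; apply: cmor_pr1. Qed.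

Lemma lshear_comp D (f g : D ⟶ H) : lshear f ∘ lshear g = lshear (f ⋆ g).
Proof.
have m1 := cmor_pr1 D V.
by rewrite [lshear g]lshearE lshear_pair // -lact_conv -pair_comp // lcompA
  -lshearE.
Qed.

Lemma eta_eps_comp D E (d : E ⟶ D) : cmor d -> eta_eps ∘ d = eta_eps :> (E ⟶ H).
Proof. by case=> _ cd; apply: lin_ext => x; rewrite lcompE !eta_epsE cd. Qed.

Lemma lshear1 D : lshear (eta_eps : D ⟶ H) = lid.
Proof.
by rewrite lshearE eta_eps_comp ?lact_unit ?pair_pr //; apply: cmor_pr1.
Qed.

Lemma lshear_nat D E (f : D ⟶ H) (d : E ⟶ D) :
  cmor d -> lshear f ∘ (d ⊠ lid) = (d ⊠ lid) ∘ lshear (f ∘ d).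
Proof.
move=> md; have m1 := cmor_pr1 E V.
rewrite tm_pairE lshear_pair; last exact: cmor_comp.
by rewrite -tm_pairE lshearE tm_pair !lcomp1f lcompA.
Qed.

End LeftAction.

Section RightAction.
Variables (k : fieldType) (H : hopfType k) (V : coalgType k) (act : V ⨂ H ⟶ V).
Hypothesis actA : act ∘ (lid ⊠ mu) ∘ assoc = act ∘ (act ⊠ lid).
Hypothesis act1 : act ∘ insr V 1 = lid.
Implicit Types D E : coalgType k.

Lemma ract_conv D (f g : D ⟶ H) (x : D ⟶ V) :
  act ∘ ⟨x, f ⋆ g⟩ = act ∘ ⟨act ∘ ⟨x, f⟩, g⟩.
Proof.
have -> : ⟨x, f ⋆ g⟩ = (lid ⊠ mu) ∘ (assoc ∘ ⟨⟨x, f⟩, g⟩).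
  by rewrite pairA tm_pair lcomp1f.
by rewrite !lcompA actA -lcompA tm_pair lcomp1f.
Qed.

Lemma ract_unit D (x : D ⟶ V) : act ∘ ⟨x, eta_eps⟩ = x.
Proof. by rewrite pair_eta_eps lcompA act1 lcomp1f. Qed.

(** The map v (x) d |-> v f(d1) (x) d2, the right-handed counterpart of
[lshear]. *)
Definition rshear D (f : D ⟶ H) : V ⨂ D ⟶ V ⨂ D :=
  ((act ∘ (lid ⊠ f)) ⊠ lid) ∘ (assocI ∘ (lid ⊠ cop)).

Lemma rshear_pair D E (f : D ⟶ H) (d : E ⟶ D) (x : E ⟶ V) :
  cmor d -> rshear f ∘ ⟨x, d⟩ = ⟨act ∘ ⟨x, f ∘ d⟩, d⟩.
Proof.
case=> cd _; rewrite /rshear -lcompA -[_ ∘ ⟨x, d⟩]lcompA tm_pair cd pairAI.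
by rewrite tm_pair -[act ∘ _ ∘ _]lcompA tm_pair !lcomp1f.
Qed.

Lemma rshearE D (f : D ⟶ H) : rshear f = ⟨act ∘ ⟨pr1, f ∘ pr2⟩, pr2⟩.
Proof. by rewrite -rshear_pair ?pair_pr ?lcompf1 //; apply: cmor_pr2. Qed.

Lemma rshear_comp D (f g : D ⟶ H) : rshear f ∘ rshear g = rshear (g ⋆ f).
Proof.
have m2 := cmor_pr2 V D.
by rewrite [rshear g]rshearE rshear_pair // -ract_conv -pair_comp // lcompA
  -rshearE.
Qed.

Lemma rshear1 D : rshear (eta_eps : D ⟶ H) = lid.
Proof.
by rewrite rshearE eta_eps_comp ?ract_unit ?pair_pr //; apply: cmor_pr2.
Qed.

End RightAction.

(** * Convolution and the exchange law *)

Section Convolution.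
Variables (k : fieldType) (H : hopfType k).
Implicit Types C D : coalgType k.

Lemma muA : mu ∘ (mu ⊠ lid) = mu ∘ (lid ⊠ mu) ∘ assoc :> (H ⨂ H ⨂ H ⟶ H).
Proof. by apply: tens_ext3 => a b c; rewrite !tE !muE mulrA. Qed.
Lemma mu_insl : mu ∘ insl H 1 = lid.
Proof. by apply: lin_ext => x; rewrite lcompE inslE muE mul1r. Qed.
Lemma mu_insr : mu ∘ insr H 1 = lid.
Proof. by apply: lin_ext => x; rewrite lcompE insrE muE mulr1. Qed.

Lemma cop_mu : cop ∘ mu = (mu ⊠ mu) ∘ inter ∘ (cop ⊠ cop) :> (H ⨂ H ⟶ _).
Proof. by apply: tens_ext2 => a b; rewrite !tE muE; apply: comulM. Qed.

Lemma cmor_mu : cmor (mu : H ⨂ H ⟶ H).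
Proof.
split; first by rewrite cop_mu pairE cop_tens lcompA.
by apply: counit_ext => a b; rewrite muE counitM.
Qed.

Lemma convA D (f g h : D ⟶ H) : (f ⋆ g) ⋆ h = f ⋆ (g ⋆ h).
Proof. exact: (lact_conv muA). Qed.
Lemma conv1f D (f : D ⟶ H) : eta_eps ⋆ f = f.
Proof. exact: (lact_unit mu_insl). Qed.
Lemma convf1 D (f : D ⟶ H) : f ⋆ eta_eps = f.
Proof. exact: (ract_unit mu_insr). Qed.

Lemma conv_comp C D (f g : D ⟶ H) (F : C ⟶ D) :
  cmor F -> (f ⋆ g) ∘ F = (f ∘ F) ⋆ (g ∘ F).
Proof. by move=> mF; rewrite -lcompA pair_comp. Qed.

Lemma convS1 : anti ⋆ lid = eta_eps :> (H ⟶ H).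
Proof. by apply: lin_ext => x; rewrite pairE eta_epsE; apply: antipodel. Qed.
Lemma conv1S : lid ⋆ anti = eta_eps :> (H ⟶ H).
Proof. by apply: lin_ext => x; rewrite pairE eta_epsE; apply: antipoder. Qed.

Lemma convSf D (f : D ⟶ H) : cmor f -> (anti ∘ f) ⋆ f = eta_eps.
Proof.
by move=> mf; rewrite -[f in _ ⋆ f]lcomp1f -conv_comp // convS1
  eta_eps_comp.
Qed.
Lemma convfS D (f : D ⟶ H) : cmor f -> f ⋆ (anti ∘ f) = eta_eps.
Proof.
by move=> mf; rewrite -[f in f ⋆ _]lcomp1f -conv_comp // conv1S
  eta_eps_comp.
Qed.

(** Acting by the composite of [f] with the antipode undoes acting by [f], since
a comultiplicative [f] is convolution invertible. *)
Lemma lact_cancel V (act : H ⨂ V ⟶ V) D (f : D ⟶ H) (x y : D ⟶ V) :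
  act ∘ (mu ⊠ lid) = act ∘ (lid ⊠ act) ∘ assoc -> act ∘ insl V 1 = lid ->
  cmor f -> act ∘ ⟨f, x⟩ = act ∘ ⟨f, y⟩ -> x = y.
Proof.
move=> actA act1 mf E.
rewrite -(lact_unit act1 x) -(lact_unit act1 y) -(convSf mf).
by rewrite !(lact_conv actA) E.
Qed.

Lemma ract_cancel V (act : V ⨂ H ⟶ V) D (f : D ⟶ H) (x y : D ⟶ V) :
  act ∘ (lid ⊠ mu) ∘ assoc = act ∘ (act ⊠ lid) -> act ∘ insr V 1 = lid ->
  cmor f -> act ∘ ⟨x, f⟩ = act ∘ ⟨y, f⟩ -> x = y.
Proof.
move=> actA act1 mf E.
rewrite -(ract_unit act1 x) -(ract_unit act1 y) -(convfS mf).
by rewrite !(ract_conv actA) E.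
Qed.

Lemma conv_cancell D (f g h : D ⟶ H) : cmor f -> f ⋆ g = f ⋆ h -> g = h.
Proof. exact: lact_cancel muA mu_insl. Qed.
Lemma conv_cancelr D (f g h : D ⟶ H) : cmor f -> g ⋆ f = h ⋆ f -> g = h.
Proof. exact: ract_cancel (esym muA) mu_insr. Qed.

(** In Sweedler indices, Delta of the convolution product of [f] and [g] is
f1 g2 (x) f3 g4 since this product is comultiplicative, and f1 g3 (x) f2 g4
since Delta is multiplicative.  Cancelling f1 on the left of the left leg and g4
on the right of the right leg exchanges the two inner factors. *)
Lemma pair_comm D (f g : D ⟶ H) : cmor f -> cmor g -> cmor (f ⋆ g) ->
  ⟨f, g⟩ = swap ∘ ⟨g, f⟩.
Proof.
move=> mf mg mfg.
(* [H] acts on the left leg of H (x) H by left multiplication, and on its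
   right leg by right multiplication. *)
pose la : H ⨂ (H ⨂ H) ⟶ H ⨂ H := (mu ⊠ lid) ∘ assocI.
pose ra : (H ⨂ H) ⨂ H ⟶ H ⨂ H := (lid ⊠ mu) ∘ assoc.
have laA : la ∘ (mu ⊠ lid) = la ∘ (lid ⊠ la) ∘ assoc.
  apply: (@tens_ext4 _ _ _ _ _ _ (la ∘ (mu ⊠ lid))) => a b c d.
  by rewrite !tE !muE mulrA.
have la1 : la ∘ insl _ 1 = lid.
  by apply: tens_ext2 => a b; rewrite !lcompE inslE !tE muE mul1r.
have raA : ra ∘ (lid ⊠ mu) ∘ assoc = ra ∘ (ra ⊠ lid).
  have E : ra ∘ (lid ⊠ mu) = ra ∘ (ra ⊠ lid) ∘ assocI.
    apply: (@tens_ext4 _ _ _ _ _ _ (ra ∘ (lid ⊠ mu))) => a b c d.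
    by rewrite !tE !muE mulrA.
  by rewrite E -lcompA assocK lcompf1.
have ra1 : ra ∘ insr _ 1 = lid.
  by apply: tens_ext2 => a b; rewrite !lcompE insrE !tE muE mulr1.
have laE (x y z : D ⟶ H) : la ∘ ⟨x, ⟨y, z⟩⟩ = ⟨x ⋆ y, z⟩.
  by rewrite -lcompA pairAI tm_pair lcomp1f.
have raE (x y z : D ⟶ H) : ra ∘ ⟨⟨x, y⟩, z⟩ = ⟨x, y ⋆ z⟩.
  by rewrite -lcompA pairA tm_pair lcomp1f.
have [[cf _] [cg _] [cfg _]] := And3 mf mg mfg.
have inter_act : (mu ⊠ mu) ∘ inter =
    la ∘ (lid ⊠ (ra ∘ (swap ⊠ lid) ∘ assocI)) ∘ assoc.
  by apply: tens_ext4 => a b c d; rewrite !tE !muE.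
(* Both sides are the comultiplication composed with [f ⋆ g]. *)
have E : la ∘ ⟨f, ra ∘ ⟨⟨g, f⟩, g⟩⟩ = la ∘ ⟨f, ra ∘ ⟨swap ∘ ⟨f, g⟩, g⟩⟩.
  rewrite raE laE -cfg lcompA cop_mu -lcompA tm_pair cf cg inter_act.
  by rewrite -!lcompA pairA tm_pair lcomp1f -!lcompA pairAI tm_pair lcomp1f.
have -> : ⟨g, f⟩ = swap ∘ ⟨f, g⟩.
  apply: (ract_cancel raA ra1 mg); exact: (lact_cancel laA la1 mf E).
by rewrite lcompA swapK lcomp1f.
Qed.

End Convolution.

(** * Two actions whose product is the multiplication *)

Ltac cmor_comps := repeat match goal with
  | |- cmor (_ ∘ _) => apply: cmor_comp
  end; try assumption.

Section MatchedPair.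
Variables (k : fieldType) (H : hopfType k).
Variables s1 s2 : H ⨂ H ⟶ H.
Hypotheses (ms1 : cmor s1) (ms2 : cmor s2).
Hypothesis s1A : s1 ∘ (mu ⊠ lid) = s1 ∘ (lid ⊠ s1) ∘ assoc.
Hypothesis s1u : s1 ∘ insl H 1 = lid.
Hypothesis s2A : s2 ∘ (lid ⊠ mu) ∘ assoc = s2 ∘ (s2 ⊠ lid).
Hypothesis s2u : s2 ∘ insr H 1 = lid.
Hypothesis s1s2 : s1 ⋆ s2 = mu.

Let s : H ⨂ H ⟶ H ⨂ H := ⟨s1, s2⟩.

(** The convolution product of the two components is [mu], which is a coalgebra
morphism since [H] is a bialgebra. *)
Lemma s_comm : s = swap ∘ ⟨s2, s1⟩.
Proof. by apply: pair_comm => //; rewrite s1s2; apply: cmor_mu. Qed.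

Lemma cmor_s : cmor s.
Proof. by apply: cmor_pair => //; apply: s_comm. Qed.

Lemma pr1_s : pr1 ∘ s = s1.
Proof. by rewrite pr1_pair. Qed.
Lemma pr2_s : pr2 ∘ s = s2.
Proof. by rewrite pr2_pair. Qed.

Notation H3 := (H ⨂ H ⨂ H).
Let p1 : H3 ⟶ H := pr1 ∘ pr1.
Let p2 : H3 ⟶ H := pr2 ∘ pr1.
Let p3 : H3 ⟶ H := pr2.
Let p12 : H3 ⟶ H ⨂ H := pr1.
Let p23 : H3 ⟶ H ⨂ H := ⟨p2, p3⟩.
Let mL : H3 ⟶ H ⨂ H := mu ⊠ lid.
Let mR : H3 ⟶ H ⨂ H := (lid ⊠ mu) ∘ assoc.

Let cmor_id := cmor_lid H.
Let cmor_fst := cmor_pr1 H H.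
Let cmor_snd := cmor_pr2 H H.
Let cmor_p12 : cmor p12 := cmor_pr1 (H ⨂ H) H.
Let cmor_p1 : cmor p1. Proof. exact: cmor_comp. Qed.
Let cmor_p2 : cmor p2. Proof. exact: cmor_comp. Qed.
Let cmor_p3 : cmor p3 := cmor_pr2 (H ⨂ H) H.

Let p12E : p12 = ⟨p1, p2⟩.
Proof. by rewrite -(cmor_eta cmor_p12). Qed.
Let assoc_p : assoc = ⟨p1, p23⟩ :> (H3 ⟶ _).
Proof. by rewrite -pairA -p12E pair_pr lcompf1. Qed.
Let p23E : pr2 ∘ assoc = p23.
Proof. by rewrite assoc_p pr2_pair. Qed.
Let cmor_p23 : cmor p23.
Proof.
by rewrite -p23E; apply: cmor_comp; [apply: cmor_pr2|apply: cmor_assoc].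
Qed.
Let mLE : mL = ⟨mu ∘ p12, p3⟩.
Proof. by rewrite /mL tm_pairE lcomp1f. Qed.
Let mRE : mR = ⟨p1, mu ∘ p23⟩.
Proof. by rewrite /mR assoc_p tm_pair lcomp1f. Qed.
Let cmor_mL : cmor mL.
Proof. by apply: cmor_tm => //; apply: cmor_mu. Qed.
Let cmor_mR : cmor mR.
Proof.
apply: cmor_comp; last exact: cmor_assoc.
by apply: cmor_tm => //; apply: cmor_mu.
Qed.
Let mu_mLR : mu ∘ mL = mu ∘ mR.
Proof. by rewrite /mL /mR muA lcompA. Qed.
Let s1_mL : s1 ∘ mL = s1 ∘ ⟨p1, s1 ∘ p23⟩.
Proof. by rewrite /mL s1A -lcompA assoc_p tm_pair lcomp1f. Qed.
Let s2_mR : s2 ∘ mR = s2 ∘ ⟨s2 ∘ p12, p3⟩.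
Proof. by rewrite /mR lcompA s2A tm_pairE lcomp1f. Qed.

(* h (x) l (x) m |-> h (x) (l . m) and h (x) l (x) m |-> (h ^ l) (x) m. *)
Let u : H3 ⟶ H ⨂ H := ⟨p1, s1 ∘ p23⟩.
Let v : H3 ⟶ H ⨂ H := ⟨s2 ∘ p12, p3⟩.
Let cmor_u : cmor u.
Proof.
have -> : u = (lid ⊠ s1) ∘ assoc by rewrite assoc_p tm_pair lcomp1f.
by apply: cmor_comp; [apply: cmor_tm|apply: cmor_assoc].
Qed.
Let cmor_v : cmor v.
Proof.
have -> : v = s2 ⊠ lid by rewrite tm_pairE lcomp1f.
exact: cmor_tm.
Qed.

(** h . (l m) = (h1 . l1) ((h2 ^ l2) . m): after multiplying on the right by
h ^ (l m) = (h ^ l) ^ m, both sides become h l m. *)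
Lemma s1_mulr : s1 ∘ mR = (s1 ∘ p12) ⋆ (s1 ∘ v).
Proof.
apply: (conv_cancelr (f := s2 ∘ mR)); first exact: cmor_comp.
rewrite -conv_comp // s1s2 convA s2_mR -conv_comp // s1s2.
by rewrite /v -convA -conv_comp // s1s2 -mu_mLR mLE.
Qed.

(** (h l) ^ m = (h ^ (l1 . m1)) (l2 ^ m2): after multiplying on the left by
(h l) . m = h . (l . m), both sides become h l m. *)
Lemma s2_mull : s2 ∘ mL = (s2 ∘ u) ⋆ (s2 ∘ p23).
Proof.
apply: (conv_cancell (f := s1 ∘ mL)); first exact: cmor_comp.
rewrite -conv_comp // s1s2 -convA s1_mL -/u -conv_comp // s1s2.
by rewrite /u convA -conv_comp // s1s2 mu_mLR mRE.
Qed.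

Let b12 : H3 ⟶ H3 := s ⊠ lid.
Let b23 : H3 ⟶ H3 := assocI ∘ ((lid ⊠ s) ∘ assoc).

Let b12E : b12 = ⟨s ∘ p12, p3⟩.
Proof. by rewrite /b12 tm_pairE lcomp1f. Qed.
Let b23E : b23 = ⟨u, s2 ∘ p23⟩.
Proof.
by rewrite /b23 assoc_p tm_pair lcomp1f /s pair_comp // pairAI.
Qed.
Let cmor_b12 : cmor b12.
Proof. by apply: cmor_tm => //; apply: cmor_s. Qed.
Let cmor_b23 : cmor b23.
Proof.
apply: cmor_comp; [exact: cmor_assocI|apply: cmor_comp; last exact: cmor_assoc].
by apply: cmor_tm => //; apply: cmor_s.
Qed.

Let cmor_s2p23 : cmor (s2 ∘ p23). Proof. exact: cmor_comp. Qed.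
Let cmor_s1p23 : cmor (s1 ∘ p23). Proof. exact: cmor_comp. Qed.

Let p12_b12 : p12 ∘ b12 = s ∘ p12.
Proof. by rewrite b12E pr1_pair. Qed.
Let p3_b12 : p3 ∘ b12 = p3.
Proof. by rewrite b12E pr2_pair //; apply: cmor_comp => //; apply: cmor_s. Qed.
Let p1_b12 : p1 ∘ b12 = s1 ∘ p12.
Proof. by rewrite -lcompA p12_b12 lcompA pr1_s. Qed.
Let p2_b12 : p2 ∘ b12 = s2 ∘ p12.
Proof. by rewrite -lcompA p12_b12 lcompA pr2_s. Qed.
Let p23_b12 : p23 ∘ b12 = v.
Proof. by rewrite pair_comp // p2_b12 p3_b12. Qed.
Let p12_b23 : p12 ∘ b23 = u.
Proof. by rewrite b23E pr1_pair. Qed.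
Let p3_b23 : p3 ∘ b23 = s2 ∘ p23.
Proof. by rewrite b23E pr2_pair. Qed.
Let p1_b23 : p1 ∘ b23 = p1.
Proof. by rewrite -lcompA p12_b23 pr1_pair. Qed.
Let p2_b23 : p2 ∘ b23 = s1 ∘ p23.
Proof. by rewrite -lcompA p12_b23 pr2_pair. Qed.
Let p23_b23 : p23 ∘ b23 = s ∘ p23.
Proof. by rewrite pair_comp // p2_b23 p3_b23 /s pair_comp. Qed.

Let cmor_mup12 : cmor (mu ∘ p12).
Proof. by apply: cmor_comp => //; apply: cmor_mu. Qed.
Let cmor_mup23 : cmor (mu ∘ p23).
Proof. by apply: cmor_comp => //; apply: cmor_mu. Qed.
Let pr1_mL : pr1 ∘ mL = mu ∘ p12.
Proof. by rewrite mLE pr1_pair. Qed.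
Let pr2_mL : pr2 ∘ mL = p3.
Proof. by rewrite mLE pr2_pair. Qed.
Let pr1_mR : pr1 ∘ mR = p1.
Proof. by rewrite mRE pr1_pair. Qed.
Let pr2_mR : pr2 ∘ mR = mu ∘ p23.
Proof. by rewrite mRE pr2_pair. Qed.
Let u_b12 : u ∘ b12 = ⟨s1 ∘ p12, s1 ∘ v⟩.
Proof. by rewrite pair_comp // p1_b12 -(lcompA s1) p23_b12. Qed.
Let v_b23 : v ∘ b23 = ⟨s2 ∘ u, s2 ∘ p23⟩.
Proof. by rewrite pair_comp // p3_b23 -(lcompA s2) p12_b23. Qed.

(** Both sides are coalgebra morphisms, so components are compared: the first
are equal since [s1] is an action, the second by [s2_mull]. *)
Lemma s_mull : s ∘ mL = mR ∘ (b12 ∘ b23).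
Proof.
have ms := cmor_s.
apply: cmor_ext; [by cmor_comps | by cmor_comps | |].
  rewrite (lcompA pr1 s) (lcompA pr1 mR) pr1_s pr1_mR (lcompA p1) p1_b12
    -(lcompA s1) p12_b23.
  exact: s1_mL.
rewrite (lcompA pr2 s) (lcompA pr2 mR) pr2_s pr2_mR -(lcompA mu) (lcompA p23)
  p23_b12 v_b23.
exact: s2_mull.
Qed.

(** The mirror image: the first components are equal by [s1_mulr], the second
since [s2] is an action. *)
Lemma s_mulr : s ∘ mR = mL ∘ (b23 ∘ b12).
Proof.
have ms := cmor_s.
apply: cmor_ext; [by cmor_comps | by cmor_comps | |].
  rewrite (lcompA pr1 s) (lcompA pr1 mL) pr1_s pr1_mL -(lcompA mu) (lcompA p12)
    p12_b23 u_b12.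
  exact: s1_mulr.
rewrite (lcompA pr2 s) (lcompA pr2 mL) pr2_s pr2_mL (lcompA p3) p3_b23
  -(lcompA s2) p23_b12.
exact: s2_mR.
Qed.

Lemma mu_s : mu ∘ s = mu.
Proof. exact: s1s2. Qed.

Let mul3 : H3 ⟶ H := mu ∘ mL.
Let mL_b12 : mL ∘ b12 = mL.
Proof.
by rewrite mLE pair_comp // p3_b12 -(lcompA mu) p12_b12 (lcompA mu)
  mu_s.
Qed.
Let mR_b23 : mR ∘ b23 = mR.
Proof.
by rewrite mRE pair_comp // p1_b23 -(lcompA mu) p23_b23 (lcompA mu)
  mu_s.
Qed.
Let mul3_b12 : mul3 ∘ b12 = mul3.
Proof. by rewrite -(lcompA mu) mL_b12. Qed.
Let mul3_b23 : mul3 ∘ b23 = mul3.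
Proof. by rewrite /mul3 mu_mLR -(lcompA mu) mR_b23. Qed.

(** Both sides are coalgebra morphisms with first component (h l) . m and third
component h ^ (l m), and composing with the threefold product gives h l m in
both cases; the middle components are then equal by cancellation. *)
Lemma s_braid : b12 ∘ (b23 ∘ b12) = b23 ∘ (b12 ∘ b23).
Proof.
set F := b12 ∘ (b23 ∘ b12); set G := b23 ∘ (b12 ∘ b23).
have mF : cmor F by rewrite /F; cmor_comps.
have mG : cmor G by rewrite /G; cmor_comps.
have E1 : p1 ∘ F = p1 ∘ G.
  rewrite (lcompA p1 b12) (lcompA p1 b23) p1_b12 p1_b23 (lcompA p1 b12) p1_b12.
  rewrite -!(lcompA s1) (lcompA p12 b23) p12_b23 (lcompA s1 u) -s1_mL.
  by rewrite -(lcompA s1 mL) mL_b12.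
have E3 : p3 ∘ F = p3 ∘ G.
  rewrite (lcompA p3 b12) (lcompA p3 b23) p3_b12 p3_b23 (lcompA p3 b23) p3_b23.
  rewrite -!(lcompA s2) (lcompA p23 b12) p23_b12 (lcompA s2 v) -s2_mR.
  by rewrite -(lcompA s2 mR) mR_b23.
have E2 : p2 ∘ F = p2 ∘ G.
  have mulE (K : H3 ⟶ H3) : cmor K -> mul3 ∘ K = (p1 ∘ K) ⋆ (p2 ∘ K) ⋆ (p3 ∘ K).
    move=> mK; rewrite /mul3 mLE p12E -(lcompA mu) pair_comp // -(lcompA mu).
    by rewrite pair_comp.
  have : mul3 ∘ F = mul3 ∘ G.
    rewrite (lcompA mul3 b12) (lcompA mul3 b23) mul3_b12 mul3_b23.
    by rewrite (lcompA mul3 b12) (lcompA mul3 b23) mul3_b12 mul3_b23.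
  rewrite !mulE // E1 E3 => /conv_cancelr E.
  by apply: (conv_cancell (f := p1 ∘ G)); [cmor_comps | apply: E; cmor_comps].
apply: cmor_ext => //; apply: cmor_ext; try exact: cmor_comp.
  by rewrite !(lcompA pr1 p12).
by rewrite !(lcompA pr2 p12).
Qed.

(* 1 ^ h = eps(h) 1, because h = (1 . h1) (1 ^ h2) = h1 (1 ^ h2); similarly for
   h . 1. *)
Let s2_unit : s2 ∘ insl H 1 = eta_eps.
Proof.
have mi := cmor_insl H H.
apply: (conv_cancell (cmor_lid H)); rewrite convf1.
rewrite -[in LHS]s1u -conv_comp // s1s2.
by apply: lin_ext => x; rewrite lcompE muE mul1r.
Qed.

Let s1_unit : s1 ∘ insr H 1 = eta_eps.
Proof.
have mi := cmor_insr H H.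
apply: (conv_cancelr (cmor_lid H)); rewrite conv1f.
rewrite -[in LHS]s2u -conv_comp // s1s2.
by apply: lin_ext => x; rewrite lcompE muE mulr1.
Qed.

Lemma s_unitl : s ∘ insl H 1 = insr H 1.
Proof.
have mi := cmor_insl H H.
by rewrite pair_comp // s1u s2_unit pair_eta_eps lcompf1.
Qed.
Lemma s_unitr : s ∘ insr H 1 = insl H 1.
Proof.
have mi := cmor_insr H H.
by rewrite pair_comp // s2u s1_unit eta_eps_pair lcompf1.
Qed.

(** * Bijectivity *)

(* h (x) l |-> h1 (x) (h2 . l), and its inverse. *)
Let Phi : H ⨂ H ⟶ H ⨂ H := lshear s1 lid.
Let Phi' : H ⨂ H ⟶ H ⨂ H := lshear s1 (@anti k H).
Let PhiK : Phi' ∘ Phi = lid.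
Proof. by rewrite lshear_comp // -[anti]lcompf1 convSf ?lshear1. Qed.
Let Phi'K : Phi ∘ Phi' = lid.
Proof. by rewrite lshear_comp // -[anti]lcompf1 convfS ?lshear1. Qed.
Let PhiE : Phi = ⟨pr1, s1⟩.
Proof. by rewrite /Phi lshearE lcomp1f pair_pr lcompf1. Qed.

(* psi (h (x) u) = h1 ^ (anti(h2) . u). *)
Let psi : H ⨂ H ⟶ H := s2 ∘ Phi'.
Let psi_Phi : psi ∘ Phi = s2.
Proof. by rewrite -lcompA PhiK lcompf1. Qed.

(* Both sides send h (x) l (x) m to h1 (x) (h2 . (l m)): this is [s1_mulr] with
   the first factor kept. *)
Let Phi_mulr : Phi ∘ mR = mR ∘ (Phi ⊠ lid) ∘ lshear s1 s2.
Proof.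
rewrite {1}/Phi {1}mRE lshear_pair // lcomp1f -mRE s1_mulr.
rewrite lshearE -lcompA tm_pair lcomp1f PhiE pair_comp // /mR -lcompA pairA
  tm_pair.
by rewrite lcomp1f.
Qed.

(** As [Phi (x) id] is onto, it suffices to check the axiom after composing with
it, where [psi] becomes [s2].  By [Phi_mulr] the left-hand side is then
s2 (id (x) mu) after the inverse of the shear along [s2], and the action axiom
of [s2] together with naturality of shears along the coalgebra morphism [s2]
brings it to psi (s2 (x) id). *)
Lemma psiA : psi ∘ (lid ⊠ mu) ∘ assoc = psi ∘ (psi ⊠ lid).
Proof.
have K : (Phi ⊠ lid) ∘ (Phi' ⊠ lid) = lid :> (H3 ⟶ H3).
  by rewrite tm_comp Phi'K lcompf1 tm1.
rewrite -[LHS]lcompf1 -[RHS]lcompf1 -K !(lcompA _ (Phi ⊠ lid)); congr (_ ∘ _).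
pose W := lshear s1 (anti ∘ s2).
have WK : lshear s1 s2 ∘ W = lid by rewrite lshear_comp // convfS ?lshear1.
have e1 : mR ∘ (Phi ⊠ lid) = Phi ∘ mR ∘ W.
  by rewrite Phi_mulr -(lcompA (mR ∘ _)) WK lcompf1.
have e2 : s2 ∘ mR ∘ W = psi ∘ (s2 ⊠ lid).
  by rewrite /mR (lcompA s2) s2A -(lcompA s2) -(lshear_nat s1 anti ms2) lcompA.
rewrite -(lcompA psi _ assoc) -(lcompA psi mR) e1 -(lcompA Phi).
rewrite (lcompA psi Phi) psi_Phi (lcompA s2) e2.
by rewrite -(lcompA psi) tm_comp psi_Phi lcompf1.
Qed.

Lemma psi1 : psi ∘ insr H 1 = lid.
Proof.
have mi := cmor_insr H H.
have PhiI : Phi ∘ insr H 1 = insr H 1.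
  by rewrite PhiE pair_comp // s1_unit pr1_insr pair_eta_eps lcompf1.
by rewrite -PhiI lcompA psi_Phi s2u.
Qed.

(** The exchange law gives swap s = <s2, s1> = <psi Phi, s1>, which is the right
shear along [psi] composed with Phi = <pr1, s1>. *)
Lemma s_bij : bijective s.
Proof.
pose Th := rshear psi (lid : H ⟶ H).
pose Th' := rshear psi (@anti k H).
have ThK : Th' ∘ Th = lid.
  by rewrite (rshear_comp psiA) -[anti]lcompf1 convfS ?(rshear1 psi1).
have Th'K : Th ∘ Th' = lid.
  by rewrite (rshear_comp psiA) -[anti]lcompf1 convSf ?(rshear1 psi1).
have sE : s = swap ∘ (Th ∘ Phi).
  by rewrite s_comm PhiE rshear_pair // lcomp1f -PhiE psi_Phi.
exists (Phi' ∘ (Th' ∘ swap)) => x; rewrite sE.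
  rewrite -[LHS]/((Phi' ∘ (Th' ∘ (swap ∘ swap) ∘ Th) ∘ Phi) x).
  by rewrite swapK lcompf1 ThK lcompf1 PhiK.
rewrite -[LHS]/((swap ∘ (Th ∘ (Phi ∘ Phi') ∘ Th') ∘ swap) x).
by rewrite Phi'K lcompf1 Th'K lcompf1 swapK.
Qed.

End MatchedPair.

(** * Translation to bare linear maps *)

(** On [H] itself, the structure of vector space is reached both through its
algebra and through its coalgebra structure.  The equalities in this section
hold by computation; stating each operation separately keeps that computation
small. *)
Section Translation.
Variables (k : fieldType) (H : hopfType k).

Lemma tassoc_lin x : @tassoc k H H H x = (assoc : H ⨂ H ⨂ H ⟶ _) x.
Proof. by []. Qed.
Lemma tassoc_inv_lin x : @tassoc_inv k H H H x = (assocI : H ⨂ (H ⨂ H) ⟶ _) x.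
Proof. by []. Qed.
Lemma mul_left_lin x :
  tmap (@tmul k H) idfun x = ((mu : H ⨂ H ⟶ H) ⊠ (lid : H ⟶ H)) x.
Proof. by []. Qed.
Lemma mul_right_lin x :
  tmap idfun (@tmul k H) x = ((lid : H ⟶ H) ⊠ (mu : H ⨂ H ⟶ H)) x.
Proof. by []. Qed.

Section Braiding.
Variable s : {linear H ⊗ H -> H ⊗ H}.
Let r : H ⨂ H ⟶ H ⨂ H := s.

Let b12 := r ⊠ (lid : H ⟶ H).
Let b23 := assocI ∘ (((lid : H ⟶ H) ⊠ r) ∘ assoc).

Lemma tmapr_lin x : tmap (idfun : {linear H -> H}) s x = ((lid : H ⟶ H) ⊠ r) x.
Proof. by []. Qed.
Lemma s12_lin x : s12 s x = b12 x.
Proof. by []. Qed.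
Lemma s23_lin x : s23 s x = b23 x.
Proof.
rewrite -[s23 s x]/(tassoc_inv (tmap idfun s (tassoc x))).
by rewrite tassoc_lin tmapr_lin tassoc_inv_lin.
Qed.

Lemma braid_equation_lin :
  b12 ∘ (b23 ∘ b12) = b23 ∘ (b12 ∘ b23) -> braid_equation s.
Proof.
move=> E x; rewrite /comp !s12_lin !s23_lin.
exact: (congr1 (fun f : _ ⟶ _ => f x) E).
Qed.

Lemma hexagon_left_lin :
  r ∘ (mu ⊠ lid) = (lid ⊠ mu) ∘ assoc ∘ (b12 ∘ b23) ->
  s \o tmap (@tmul k H) idfun =1
    tmap idfun (@tmul k H) \o @tassoc k H H H \o s12 s \o s23 s.
Proof.
move=> E x; rewrite /comp s12_lin s23_lin tassoc_lin.
rewrite mul_right_lin mul_left_lin.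
exact: (congr1 (fun f : _ ⟶ _ => f x) E).
Qed.

Lemma hexagon_right_lin :
  r ∘ ((lid ⊠ mu) ∘ assoc) = (mu ⊠ lid) ∘ (b23 ∘ b12) ->
  s \o tmap idfun (@tmul k H) \o @tassoc k H H H =1
    tmap (@tmul k H) idfun \o s23 s \o s12 s.
Proof.
move=> E x; rewrite /comp s12_lin s23_lin tassoc_lin.
rewrite mul_right_lin mul_left_lin.
exact: (congr1 (fun f : _ ⟶ _ => f x) E).
Qed.

Lemma coalgebra_morphism_lin : cmor r -> coalgebra_morphism s.
Proof. by move/cmorP. Qed.

End Braiding.

Section Pairing.
Variables s1 s2 : {linear H ⊗ H -> H}.
Let r1 : H ⨂ H ⟶ H := s1.
Let r2 : H ⨂ H ⟶ H := s2.

Lemma tens_comul_lin x : @tens_comul k H H x = (cop : H ⨂ H ⟶ _) x.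
Proof. by []. Qed.
Lemma tmap_lin x : tmap s1 s2 x = (r1 ⊠ r2) x.
Proof. by []. Qed.
Lemma pair_lin x : (tmap s1 s2 \o @tens_comul k H H) x = ⟨r1, r2⟩ x.
Proof. by rewrite pairE lcompE -tmap_lin -tens_comul_lin. Qed.

End Pairing.
End Translation.

Theorem theorem5p27 (k : fieldType) (H : hopfType k)
    (s1 s2 : {linear H ⊗ H -> H}) :
  let s : {linear H ⊗ H -> H ⊗ H} := tmap s1 s2 \o @tens_comul k H H in
  left_module_coalgebra s1 ->
  right_module_coalgebra s2 ->
  (forall h l : H, tmul (s (h ⊗ₜ l)) = h * l) ->
  braiding_operator s /\ (bijective s /\ braid_equation s).
Proof.
move=> s [e1u e1A /cmorP m1] [e2u e2A /cmorP m2] sM.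
pose r1 : H ⨂ H ⟶ H := s1; pose r2 : H ⨂ H ⟶ H := s2.
pose r : H ⨂ H ⟶ H ⨂ H := s.
have sE x : s x = ⟨r1, r2⟩ x by exact: pair_lin.
have rE : r = ⟨r1, r2⟩ by apply: lin_ext => x; exact: sE.
have r1u : r1 ∘ insl H 1 = lid by apply: lin_ext => x; apply: e1u.
have r2u : r2 ∘ insr H 1 = lid by apply: lin_ext => x; apply: e2u.
have r1A : r1 ∘ (mu ⊠ lid) = r1 ∘ (lid ⊠ r1) ∘ assoc.
  by apply: tens_ext3 => a b c; rewrite !tE muE; apply: e1A.
have r2A : r2 ∘ (lid ⊠ mu) ∘ assoc = r2 ∘ (r2 ⊠ lid).
  by apply: tens_ext3 => a b c; rewrite !tE muE; apply: e2A.
have r12 : r1 ⋆ r2 = mu.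
  by rewrite -rE; apply: tens_ext2 => a b; rewrite muE -sM.
have sb : braid_equation s.
  by apply: braid_equation_lin; rewrite -/r rE; apply: s_braid.
split; last first.
  split=> //; have [g gK Kg] := s_bij m1 m2 r1A r1u r2A r2u r12.
  exists g => y; last by rewrite sE Kg.
  by rewrite sE gK.
split; last first.
  by move=> x; rewrite /= -[RHS]/((mu ∘ r) x) rE r12.
split.
- split=> //; apply: coalgebra_morphism_lin; rewrite -/r rE; exact: cmor_s.
- apply: hexagon_left_lin; rewrite -/r rE; exact: s_mull.
- apply: hexagon_right_lin; rewrite -/r rE; exact: s_mulr.
- by move=> h; rewrite sE -[LHS]/((⟨r1, r2⟩ ∘ insl H 1) h) s_unitl.
by move=> h; rewrite sE -[LHS]/((⟨r1, r2⟩ ∘ insr H 1) h) s_unitr.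
Qed.
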